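(* Let $Z$ be a twistor space on $n\mathbf{CP}^2$ as in the context (with $n\ge4$), and let $\mathcal T=\Phi_{n-1}^{\mathbf C^*}(Z)\subset\mathbf{CP}^{n+1}$ be the image surface, with the homogeneous coordinates $(z_1,\dots,z_{n+2})$ of the context. Let $l_\infty=\{z_1=z_2=\dots=z_n=0\}$. Then the singularities of $\mathcal T$ consist of the following three points: (a) the two intersection points $l_\infty\cap\mathcal T=\{(0,0,\dots,0,1,0),(0,0,\dots,0,0,1)\}$; (b) the point $(0,\dots,0,1,0,0)$. Further, the two points of (a) are isomorphic to the cyclic quotient singularity of the $\mathbf Z_{n-1}$-action $(z,w)\mapsto(\zeta z,\zeta w)$ on $\mathbf C^2$ with $\zeta=e^{\frac{2\pi\sqrt{-1}}{n-1}}$. The point (b) is isomorphic to a rational double point of $A_{n-3}$-type.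
   Context: Fix $n\ge 4$. $n\mathbf{CP}^2$ is the connected sum of $n$ copies of $\mathbf{CP}^2$. A twistor space $Z$ on $n\mathbf{CP}^2$ is the twistor space of a self-dual metric on it: a compact complex threefold with a fibration $Z\to n\mathbf{CP}^2$ whose fibers (twistor lines) are smooth rational curves with normal bundle $\mathcal O(1)^{\oplus 2}$, equipped with a real structure $\sigma$ (anti-holomorphic involution) preserving each twistor line and without fixed points. Overlines denote $\sigma$-conjugates. $F$ is the canonical square root of $K_Z^{-1}$ (a real line bundle). The degree of a divisor on $Z$ is its intersection number with twistor lines. The surface $S$. Give $\mathbf{CP}^1\times\mathbf{CP}^1$ the real structure (complex conjugation)$\times$(antipodal). Choose a non-real curve $C_1\in|\mathcal O(1,0)|$ and a point $P_1\in C_1$. Blow up $P_1,\overline P_1$; then blow up the intersection points of (the strict transforms of) $C_1\cup\overline C_1$ with the exceptional curves of the last blow-ups; repeat until $n-1$ conjugate pairs of points have been blown up, giving a toric surface $S'$ on which $C_1^2=\overline C_1^2=1-n$. Finally blow up a conjugate pair of points lying on the exceptional curves of the last blow-ups, which are not fixed points of the torus and do not belong to the same $\mathbf C^*$-orbit closure (for the remaining $\mathbf C^*$-action). The result is $S$, with a non-trivial $\mathbf C^*$-action, a real structure and $c_1^2=8-2n$. $S$ has a unique anticanonical curve, the cycle $C=\sum_{i=1}^{n+1}C_i+\sum_{i=1}^{n+1}\overline C_i$ of $2n+2$ smooth rational curves in the cyclic order $C_1,\dots,C_{n+1},\overline C_1,\dots,\overline C_{n+1}$, with $C_1^2=1-n$,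 $C_2^2=\dots=C_n^2=-2$, $C_{n+1}^2=-1$; $C_2,\overline C_2$ are the only components pointwise fixed by $\mathbf C^*$. Setting. $Z$ is a twistor space on $n\mathbf{CP}^2$ with a $\mathbf C^*$-action compatible with the real structure, such that $S$ is equivariantly contained in $Z$ as a real $\mathbf C^*$-invariant member of $|F|$. Then $|F|=|F|^{\mathbf C^*}$ is a pencil with base locus $C$ having precisely $n+1$ reducible members $S_i^++S_i^-$ ($1\le i\le n+1$), where $S_i^\pm$ are mutually conjugate $\mathbf C^*$-invariant divisors of degree one, and $L_i=S_i^+\cap S_i^-$ is a $\mathbf C^*$-invariant twistor line. The indexing is such that $L_i$ passes through $C_{i-1}\cap C_i$ ($C_0:=\overline C_{n+1}$) and $S_i^+\supset C_{n+1}$. The surface $\mathcal T$. $\Phi_{n-1}^{\mathbf C^*}:Z\to\mathbf P^\vee H^0((n-1)F)^{\mathbf C^*}$ is the meromorphic map associated to the space of $\mathbf C^*$-invariant sections of $(n-1)F$. Let $e_i$ be a section of $[S_i^+]$ defining $S_i^+$ and $y_i=e_i\overline e_i\in H^0(F)$. Then $y_1,y_2$ is a basis of $H^0(F)$ and $y_i=y_2-\lambda_iy_1$ for distinct nonzero real numbers $\lambda_3,\dots,\lambda_{n+1}$. Put $z_k=y_1^{n-k}y_2^{k-1}$ ($1\le k\le n$), $z_{n+1}=e_1^{n-2}e_2\cdots e_{n+1}$, $z_{n+2}=\overline z_{n+1}$; these form a basis of $H^0((n-1)F)^{\mathbf C^*}\simeq\mathbf C^{n+2}$, so are homogeneous coordinates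 on $\mathbf P^\vee H^0((n-1)F)^{\mathbf C^*}=\mathbf{CP}^{n+1}$. The surface $\mathcal T$ is the intersection in $\mathbf{CP}^{n+1}$ of the cone over the rational normal curve $\Lambda_{n-1}=\overline{\{(1,\lambda,\dots,\lambda^{n-1})\}}\subset\mathbf{CP}^{n-1}$ (given by the equations of $\Lambda_{n-1}$ in $z_1,\dots,z_n$) with the quadric $z_{n+1}z_{n+2}=z_2(z_n-\sigma_1z_{n-1}+\sigma_2z_{n-2}-\cdots+(-1)^{n-1}\sigma_{n-1}z_1)$, where $\sigma_i$ is the degree-$i$ elementary symmetric polynomial of $\lambda_3,\dots,\lambda_{n+1}$. *)

(* Defs.v *)
From HB Require Import structures.
From mathcomp Require Import all_boot all_order all_algebra.
From mathcomp Require Import complex.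
(* multinomials is not imported: its notations clash with those of
   mathcomp-analysis. *)
From mathcomp Require mpoly.
From mathcomp Require Import all_classical all_reals all_analysis.

Set Implicit Arguments.
Unset Strict Implicit.
Unset Printing Implicit Defensive.

Import Order.TTheory GRing.Theory Num.Theory.
Import numFieldNormedType.Exports.

Local Open Scope classical_set_scope.
Local Open Scope ring_scope.

(* Everything below is used with K = R[i] for a real number structure R : there,
   differentiable means Frechet differentiable over the complex numbers, so
   that a function differentiable at all points of an open set is a holomorphic
   one. *)

Definition holomorphic_on (K : numFieldType) (m n : nat)
    (U : set 'rV[K]_m) (f : 'rV[K]_m -> 'rV[K]_n) : Prop :=
  open U /\ forall x, U x -> differentiable f x.

(* The germs at p of X and at q of Y are isomorphic, as germs of reduced
   complex analytic spaces embedded in affine spaces: a holomorphic map on X is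
   the restriction of a holomorphic map on the ambient space. *)
Definition germ_iso (K : numFieldType) (m n : nat)
    (X : set 'rV[K]_m) (p : 'rV[K]_m) (Y : set 'rV[K]_n) (q : 'rV[K]_n) : Prop :=
  exists (U : set 'rV[K]_m) (V : set 'rV[K]_n)
         (f : 'rV[K]_m -> 'rV[K]_n) (g : 'rV[K]_n -> 'rV[K]_m),
  [/\ (X `&` U) p /\ f p = q,
      holomorphic_on U f /\ holomorphic_on V g,
      forall x, (X `&` U) x -> (Y `&` V) (f x) /\ g (f x) = x &
      forall y, (Y `&` V) y -> (X `&` U) (g y) /\ f (g y) = y].

(* The projective space of dimension N - 1 is given by homogeneous coordinates:
   a point is represented by the nonzero vectors of a line of 'rV[K]_N, and a
   subset by the union of its points, which is a set of nonzero vectors. *)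
Definition hpoint (K : numFieldType) (N : nat) (p : 'rV[K]_N) : set 'rV[K]_N :=
  [set z | z != 0 /\ (z == p)%MS].

(* The j-th affine chart: (z_i / z_j) for i different from j. *)
Definition chart (K : numFieldType) (N : nat) (j : 'I_N) (z : 'rV[K]_N) :
    'rV[K]_N.-1 :=
  (z 0 j)^-1 *: col' j z.

Definition proj_germ_iso (K : numFieldType) (N n : nat)
    (X : set 'rV[K]_N) (p : 'rV[K]_N) (Y : set 'rV[K]_n) (q : 'rV[K]_n) : Prop :=
  exists j : 'I_N,
    p 0 j != 0 /\
    germ_iso (chart j @` (X `&` [set z | z 0 j != 0])) (chart j p) Y q.

Definition smooth_point (K : numFieldType) (N : nat)
    (X : set 'rV[K]_N) (p : 'rV[K]_N) : Prop :=
  exists d : nat, proj_germ_iso X p [set: 'rV[K]_d] 0.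

Definition singular_locus (K : numFieldType) (N : nat) (X : set 'rV[K]_N) :
    set 'rV[K]_N :=
  [set p | X p /\ ~ smooth_point X p].

Definition zeta (R : realType) (m : nat) : R[i] :=
  (cos (2 * pi / m%:R) +i* sin (2 * pi / m%:R))%C.

Definition cyclic_invariant (R : realType) (m : nat) (P : mpoly.mpoly 2 R[i]) :
    Prop :=
  forall (k : nat) (v : 'I_2 -> R[i]),
    mpoly.meval (fun i => zeta R m ^+ k * v i) P = mpoly.meval v P.

Definition generates_invariants (R : realType) (m r : nat)
    (f : r.-tuple (mpoly.mpoly 2 R[i])) : Prop :=
  (forall i : 'I_r, cyclic_invariant m (tnth f i)) /\
  (forall P, cyclic_invariant m P ->
     exists Q : mpoly.mpoly r R[i], P = mpoly.comp_mpoly f Q).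

Definition poly_map (R : realType) (r : nat)
    (f : r.-tuple (mpoly.mpoly 2 R[i])) (v : 'rV[R[i]]_2) : 'rV[R[i]]_r :=
  \row_i mpoly.meval (v 0) (tnth f i).

(* The quotient of C^2 by the action (z, w) |-> (zeta z, zeta w) of Z_m is the
   affine variety Spec C[z, w]^(Z_m); generators f of the algebra of invariants
   embed it in an affine space, with quotient map poly_map f, as the image of
   that map. *)
Definition cyclic_quotient_singularity (R : realType) (m N : nat)
    (X : set 'rV[R[i]]_N) (p : 'rV[R[i]]_N) : Prop :=
  exists (r : nat) (f : r.-tuple (mpoly.mpoly 2 R[i])),
    generates_invariants m f /\
    proj_germ_iso X p (range (poly_map f)) (poly_map f 0).

(* x^2 + y^2 + z^(k+1) = 0 *)
Definition du_val_A (K : numFieldType) (k : nat) : set 'rV[K]_3 :=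
  [set v | v 0 (inord 0) ^+ 2 + v 0 (inord 1) ^+ 2 + v 0 (inord 2) ^+ k.+1 = 0].

Definition A_singularity (K : numFieldType) (k N : nat)
    (X : set 'rV[K]_N) (p : 'rV[K]_N) : Prop :=
  proj_germ_iso X p (@du_val_A K k) 0.

(* The homogeneous coordinates z_1, ..., z_(n+2) of CP^(n+1), numbered from 1,
   and the coordinate points. *)
Definition hcoord (K : numFieldType) (n : nat) (z : 'rV[K]_n.+2) (k : nat) : K :=
  z 0 (inord k.-1).

Definition coord_point (K : numFieldType) (n k : nat) : 'rV[K]_n.+2 :=
  delta_mx 0 (inord k.-1).

(* The affine cone over the rational normal curve, the closure of the set of
   the points (1, x, ..., x^(n-1)) of CP^(n-1). *)
Definition rnc_cone (K : numFieldType) (n : nat) : set 'rV[K]_n :=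
  closure [set v | exists c x : K, v = \row_(k < n) (c * x ^+ k)].

(* lam i stands for lambda_(i+3), with i < n-1. *)
Definition sigma (R : realType) (n : nat) (lam : 'I_n.-1 -> R) (k : nat) : R :=
  mpoly.meval lam (mpoly.mesym n.-1 R k).

Definition surfaceT (R : realType) (n : nat) (lam : 'I_n.-1 -> R) :
    set 'rV[R[i]]_n.+2 :=
  [set z | [/\ z != 0,
      @rnc_cone R[i] n (\row_(k < n) hcoord z k.+1) &
      hcoord z n.+1 * hcoord z n.+2 =
      hcoord z 2 *
      \sum_(k < n) (-1) ^+ k * (sigma lam k)%:C%C * hcoord z (n - k)]].

Definition l_infty (K : numFieldType) (n : nat) : set 'rV[K]_n.+2 :=
  [set z | z != 0 /\ forall k, (1 <= k <= n)%N -> hcoord z k = 0].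
Arguments l_infty K n : clear implicits.

(* Main.v *)
(* In the charts z_1 <> 0 and z_n <> 0, T is the hypersurface u w = F(x) of C^3, with
   F = x prod_i (x - lambda_i), all of whose roots are simple, and with
   F = x^(n-2) prod_i (1 - lambda_i x) respectively. These are smooth except at the
   origin of the second one, where dividing u by the unit prod_i (1 - lambda_i x) gives
   u w = x^(n-2). At the two points of l_infty, T is a graph over the cone over the
   rational normal curve, that is, over the image of C^2 by the monomials of degree
   n-1, which generate the invariants of Z_(n-1). These three points are singular:
   if the germ at one of them were isomorphic to a germ of C^d, then d = 2, because
   there are smooth points of dimension 2 arbitrarily close, but also d > 2, because
   the tangent vectors of the curves through the point span the ambient space, which
   has dimension 3 or n. *)

Require Import Defs.
From mathcomp Require Import all_boot all_order all_algebra.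
From mathcomp Require Import complex ring lra zify separable.
From mathcomp Require mpoly.
From mathcomp Require Import all_classical all_reals all_analysis.
Import Order.TTheory GRing.Theory Num.Theory.
Import numFieldNormedType.Exports.
Import (canonicals, coercions) mpoly.
Local Open Scope classical_set_scope.
Local Open Scope ring_scope.

Set Implicit Arguments.
Unset Strict Implicit.
Unset Printing Implicit Defensive.

(** [smooth_point] allows every dimension [d], so a singular point must be shown isomorphic to no
    [K^d] whatsoever. The two maps of a germ isomorphism are inverse to each other only along the
    sets, not on the ambient spaces, so their Jacobians need not compose to the identity; this is
    why the bounds on [d] are obtained from curves lying in the set. Where u and w both vanish,
    smoothness requires x as a holomorphic function of the product u w. The local inverse of F is
    built from the roots of F - t, available over an algebraically closed field, and its derivative
    is read off from a divided difference. The closure in [rnc_cone] adds only the line over the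
    point at infinity of the curve. That line supplies the points x = 0 of the chart z_n <> 0, and
    it is the part of the image of C^2 where the first variable vanishes. *)

Local Notation co v k := (v 0 (inord k)).

(** * Isomorphisms of germs *)

Section Differentiability.
Variable K : numFieldType.

Lemma coord_differentiable_comp (V : normedModType K) m (f : V -> 'rV[K]_m) x i :
  differentiable f x -> differentiable (fun y => f y 0 i : K) x.
Proof.
move=> df; exact: (differentiable_comp df (differentiable_coord _ _ _)).
Qed.

Lemma row_differentiable (V : normedModType K) m (f : V -> 'rV[K]_m) x :
  (forall i, differentiable (fun y => f y 0 i : K) x) -> differentiable f x.
Proof.
move=> df.
have -> : f = \sum_(i < m) (fun y => f y 0 i *: (delta_mx 0 i : 'rV[K]_m)).
  by apply/funext => y; rewrite fct_sumE {1}[f y]row_sum_delta.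
by apply: differentiable_sum => i; apply: differentiableZl.
Qed.

Lemma open_preimage_fun (V : normedModType K) (f : V -> K) (B : set K) :
  (forall x, differentiable f x) -> open B -> open [set v | B (f v)].
Proof.
by move=> df oB; apply: open_comp => // x _; exact: differentiable_continuous.
Qed.

Lemma fun_sum_differentiable (V : normedModType K) m (f : 'I_m -> V -> K) x :
  (forall i, differentiable (f i) x) ->
  differentiable (fun y => \sum_(i < m) f i y) x.
Proof.
move=> df; rewrite (_ : (fun y => _) = \sum_(i < m) f i).
  exact: differentiable_sum.
by apply/funext => y; rewrite fct_sumE.
Qed.

Lemma fun_exp_differentiable (V : normedModType K) (f : V -> K) k x :
  differentiable f x -> differentiable (fun y => f y ^+ k) x.
Proof.
move=> df; elim: k => [|k ih]; first exact: differentiable_cst.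
rewrite (_ : (fun y => _) = f * (fun y => f y ^+ k)).
  exact: differentiableM.
by apply/funext => y; rewrite exprS.
Qed.

Lemma derive_coord m (f : K -> 'rV[K]_m) (a : K) i :
  differentiable f a -> ('D_1 f a) 0 i = 'D_1 (fun t => f t 0 i : K) a.
Proof.
move=> df.
have dcoord N :
    'd (fun M : 'rV[K]_m => M 0 i : K) N = (fun M => M 0 i) :> ('rV[K]_m -> K).
  (* The coordinate function is packaged as a linear map so that [diff_lin] identifies it with its
     own differential. *)
  have @c : {linear 'rV[K]_m -> K}.
    by exists (fun N : 'rV[K]_m => N 0 i); do 2![eexists]; do ?[constructor];
       rewrite ?mxE// => ? *; rewrite ?mxE//; move=> ?; rewrite !mxE.
  by rewrite -[LHS]/('d c N : _ -> _) diff_lin //; exact: coord_continuous.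
rewrite deriveE // deriveE; last exact: coord_differentiable_comp.
have -> : (fun t => f t 0 i : K) = (fun M : 'rV[K]_m => M 0 i : K) \o f by [].
rewrite [in RHS]diff_comp ?dcoord //; exact: differentiable_coord.
Qed.

Lemma differentiable_horner (p : {poly K}) (x : K) : differentiable (horner p) x.
Proof.
elim/poly_ind: p => [|p r ih].
  rewrite (_ : horner 0 = cst 0); first exact: differentiable_cst.
  by apply/funext => y; rewrite horner0.
rewrite (_ : horner _ = (horner p * id) + cst r).
  by apply: differentiableD => //; exact: differentiableM.
by apply/funext => y; rewrite !hornerE.
Qed.

Lemma fun_horner_differentiable (V : normedModType K) (F : {poly K}) (f : V -> K) x :
  differentiable f x -> differentiable (fun y => F.[f y]) x.
Proof.
by move=> df; exact: (differentiable_comp df (differentiable_horner F (f x))).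
Qed.

End Differentiability.

Section GermIso.
Variable K : numFieldType.

Lemma germ_iso_sym m n (X : set 'rV[K]_m) p (Y : set 'rV[K]_n) q :
  germ_iso X p Y q -> germ_iso Y q X p.
Proof.
move=> [U [V [f [g [[Xp fp] [hf hg] h1 h2]]]]].
exists V, U, g, f; split => //; have [] := h1 _ Xp; rewrite fp => //.
Qed.

Lemma germ_iso_mem m l (X : set 'rV[K]_m) p (Y : set 'rV[K]_l) q :
  germ_iso X p Y q -> Y q.
Proof. by move=> /germ_iso_sym [U [V [f [g [[[]]]]]]]. Qed.

Lemma open_preimage_differentiable m n (U : set 'rV[K]_m) (f : 'rV[K]_m -> 'rV[K]_n)
    (V : set 'rV[K]_n) :
  holomorphic_on U f -> open V -> open (U `&` f @^-1` V).
Proof.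
move=> [oU df] oV; rewrite openE => x [Ux Vfx]; apply: filterI.
  exact: open_nbhs_nbhs.
apply: (differentiable_continuous (df _ Ux)); exact: open_nbhs_nbhs.
Qed.

Lemma holomorphic_on_comp m n l (U : set 'rV[K]_m) (f : 'rV[K]_m -> 'rV[K]_n)
    (V : set 'rV[K]_n) (g : 'rV[K]_n -> 'rV[K]_l) :
  holomorphic_on U f -> holomorphic_on V g ->
  holomorphic_on (U `&` f @^-1` V) (g \o f).
Proof.
move=> hf [oV dg]; split; first exact: open_preimage_differentiable.
by move=> x [Ux Vfx]; apply: differentiable_comp; [case: hf => _; exact|exact: dg].
Qed.

Lemma germ_iso_trans m n l (X : set 'rV[K]_m) p (Y : set 'rV[K]_n) q
    (Z : set 'rV[K]_l) r :
  germ_iso X p Y q -> germ_iso Y q Z r -> germ_iso X p Z r.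
Proof.
move=> [U [V [f [g [[Xp fp] [hf hg] h1 h2]]]]].
move=> [V' [W [f' [g' [[Yq fq] [hf' hg'] h1' h2']]]]].
exists (U `&` f @^-1` V'), (W `&` g' @^-1` V), (f' \o f), (g \o g'); split.
- split; last by rewrite /= fp fq.
  by case: Xp => ? ?; split=> //; split=> //=; rewrite fp; case: Yq.
- by split; apply: holomorphic_on_comp.
- move=> x [Xx [Ux V'fx]].
  have [[Yfx Vfx] gfx] := h1 x (conj Xx Ux).
  have [[Zx Wx] gx] := h1' _ (conj Yfx V'fx).
  by rewrite /= gx; split => //; split => //; split => //=; rewrite gx.
- move=> z [Zz [Wz Vgz]].
  have [[Ygz V'gz] fgz] := h2' z (conj Zz Wz).
  have [[Xx Ux] fx] := h2 _ (conj Ygz Vgz).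
  by rewrite /= fx; split => //; split => //; split => //=; rewrite fx.
Qed.

Lemma germ_iso_global m n (X : set 'rV[K]_m) p (Y : set 'rV[K]_n) q f g :
  (forall x, differentiable f x) -> (forall y, differentiable g y) ->
  X p -> f p = q ->
  (forall x, X x -> Y (f x) /\ g (f x) = x) ->
  (forall y, Y y -> X (g y) /\ f (g y) = y) ->
  germ_iso X p Y q.
Proof.
move=> df dg Xp fp h1 h2; exists setT, setT, f, g; split => //.
- by split; split => //; exact: openT.
- by move=> x [Xx _]; have [? ?] := h1 x Xx.
- by move=> x [Xx _]; have [? ?] := h2 x Xx.
Qed.

(** Smoothness proofs can thus use charts sending the point anywhere and recenter at 0
    afterwards. *)
Lemma germ_iso_setT_translate m (p q : 'rV[K]_m) : germ_iso setT p setT q.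
Proof.
apply: (@germ_iso_global _ _ _ _ _ _ (fun x => x + (q - p)) (fun x => x - (q - p))).
- by move=> x; apply: differentiableD => //; exact: differentiable_cst.
- by move=> x; apply: differentiableB => //; exact: differentiable_cst.
- by [].
- by rewrite addrC subrK.
- by move=> x _; rewrite addrK.
- by move=> x _; rewrite subrK.
Qed.

(** Curves are required to stay in [X] for all parameters, not just near 0; the explicit algebraic
    curves used below do. *)
Definition tangent m (X : set 'rV[K]_m) (p v : 'rV[K]_m) :=
  exists c : K -> 'rV[K]_m,
    [/\ c 0 = p, forall t, X (c t), differentiable c 0 & 'D_1 c 0 = v].

(* The differentials of the two maps of the isomorphism compose to an endomorphism
   of K^m that factors through K^d and fixes every tangent vector. *)
Lemma germ_iso_setT_dim_ge m d (X : set 'rV[K]_m) p (q : 'rV[K]_d) :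
  germ_iso X p [set: 'rV[K]_d] q ->
  (forall M : 'M[K]_m, (forall v, tangent X p v -> v *m M = v) -> M = 1%:M) ->
  (m <= d)%N.
Proof.
move=> [U [V [f [g [[[Xp Up] fp] [[oU df] [oV dg]] h1 h2]]]]] spanX.
have Vq : V q by rewrite -fp; have [[]] := h1 _ (conj Xp Up).
pose A := 'J f p; pose B := 'J g q.
suff E : A *m B = 1%:M.
  by rewrite -(mxrank1 K m) -E (leq_trans (mxrankM_maxl _ _)) // rank_leq_col.
(* The spanning condition is phrased through endomorphisms fixing all tangent vectors, so it applies
   directly to [A *m B], whose rank is at most [d]. *)
apply: spanX => v [c [c0 Xc dc cv]].
have dfc : differentiable (f \o c) 0.
  by apply: differentiable_comp => //; rewrite c0; exact: df.
have dgfc : differentiable (g \o (f \o c)) 0.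
  by apply: differentiable_comp => //=; rewrite c0 fp; exact: dg.
(* Along a curve in [X], being inverse on [X] near [p] is enough: the composite agrees with [c] near
   0, so the derivatives at 0 agree. *)
have near_c : \forall t \near (0 : K), (g \o (f \o c)) t = c t.
  have : \forall t \near (0 : K), U (c t).
    apply: (differentiable_continuous dc); rewrite c0; exact: open_nbhs_nbhs.
  by apply: filterS => t Uct; have [_] := h1 _ (conj (Xc t) Uct).
have := @near_eq_derive K K _ _ _ 0 1 near_c.
rewrite cv deriveE // [in LHS]diff_comp //=; last by rewrite c0 fp; exact: dg.
rewrite (@diff_comp _ _ _ _ c f) //=; last by rewrite c0; exact: df.
have dcv : 'd c 0 1 = v by rewrite -cv deriveE.
rewrite c0 fp dcv /A /B /jacobian mulmxA => E.
by rewrite !mul_rV_lin1.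
Qed.

(** The same two maps, based at a nearby smooth point [p'], make a germ of [K^d] isomorphic to a
    germ of [K^e]. In [K^d] every vector is tangent to a line, so the previous dimension bound
    applies with [K^d] as the source. *)
Lemma germ_iso_setT_dim_le m d (X : set 'rV[K]_m) p (q : 'rV[K]_d) e :
  (forall U, open U -> U p -> exists p', [/\ X p', U p' &
     germ_iso X p' [set: 'rV[K]_e] 0]) ->
  germ_iso X p [set: 'rV[K]_d] q -> (d <= e)%N.
Proof.
move=> smoothX [U [V [f [g [[[Xp Up] fp] [hf hg] h1 h2]]]]].
have [p' [Xp' Up' iso_p']] := smoothX U hf.1 Up.
have iso_p : germ_iso X p' [set: 'rV[K]_d] (f p').
  by exists U, V, f, g; split.
apply: (germ_iso_setT_dim_ge (germ_iso_trans (germ_iso_sym iso_p) iso_p')) => M fixM.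
apply/row_matrixP => i; rewrite row1 rowE; apply: fixM.
have Dc : is_diff (0 : K) (cst (f p') + *:%R ^~ (delta_mx 0 i))
    (0 + *:%R ^~ (delta_mx 0 i)) by exact: is_diffD.
exists (cst (f p') + *:%R ^~ (delta_mx 0 i)); split => //.
  by rewrite /= fctE scale0r addr0.
by rewrite deriveE // (@diff_val _ _ _ _ _ _ _ Dc) fctE scale1r add0r.
Qed.

Lemma germ_nonsmooth m d e (X : set 'rV[K]_m) p (q : 'rV[K]_d) :
  (forall U, open U -> U p -> exists p', [/\ X p', U p' &
     germ_iso X p' [set: 'rV[K]_e] 0]) ->
  (forall M : 'M[K]_m, (forall v, tangent X p v -> v *m M = v) -> M = 1%:M) ->
  (e < m)%N -> ~ germ_iso X p [set: 'rV[K]_d] q.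
Proof.
move=> smoothX spanX em iso_p; move: em; rewrite ltnNge; apply/negP/negPn.
apply: leq_trans (germ_iso_setT_dim_le smoothX iso_p).
exact: (germ_iso_setT_dim_ge iso_p spanX).
Qed.

End GermIso.

(** * Local inverse of a polynomial at a simple root *)

Section PolynomialLocalInverse.
Variable K : numClosedFieldType.
Implicit Types (F : {poly K}) (x y t : K).

Lemma open_differentiable_neq0 (V : normedModType K) (f : V -> K) :
  (forall v : V, differentiable f v) -> open [set v | f v != 0].
Proof.
move=> df; rewrite openE => x /= fx0.
exact: (cvgr_neq0 _ (differentiable_continuous (df x))).
Qed.

(** The order of [K] is only partial; the harmonic expression takes the place of a minimum. *)
Lemma exists_pos_le2 (a b : K) : 0 < a -> 0 < b ->
  exists c : K, [/\ 0 < c, c <= a & c <= b].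
Proof.
move=> a0 b0; exists (a^-1 + b^-1)^-1; split.
- by rewrite invr_gt0 addr_gt0 // invr_gt0.
- by rewrite -[leRHS]invrK lef_pV2 ?posrE ?addr_gt0 ?invr_gt0 // lerDl invr_ge0 ltW.
- by rewrite -[leRHS]invrK lef_pV2 ?posrE ?addr_gt0 ?invr_gt0 // lerDr invr_ge0 ltW.
Qed.

(* If all roots of F - t were at distance at least d from y, then F(y) - t would be
   at least |lead_coef F| d^(deg F) in norm. *)
Lemma exists_root_near F y t (d : K) :
  F != 0 -> 0 < d -> `|F.[y] - t| < `|lead_coef F| * d ^+ (size F).-1 ->
  (1 < size F)%N ->
  exists2 z, `|y - z| < d & F.[z] = t.
Proof.
move=> F0 d0 Ft sF.
have szC : (size (- t%:P) < size F)%N.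
  by rewrite size_polyN; apply: leq_ltn_trans sF; exact: size_polyC_leq1.
have sFt : size (F - t%:P) = size F by rewrite size_polyDl.
have lFt : lead_coef (F - t%:P) = lead_coef F by rewrite lead_coefDl.
have [rs Ers] := closed_field_poly_normal (F - t%:P).
have rs_root z : z \in rs -> F.[z] = t.
  move=> zrs; apply/eqP; rewrite -subr_eq0.
  rewrite (_ : F.[z] - t = (F - t%:P).[z]); last by rewrite !hornerE.
  rewrite Ers hornerZ horner_prod (big_rem _ zrs) /= hornerXsubC subrr.
  by rewrite mul0r mulr0.
have srs : size rs = (size F).-1.
  rewrite -sFt Ers size_scale ?size_prod_XsubC //.
  by rewrite lFt lead_coef_eq0.
have [/hasP[z zrs zd]|/hasPn far] := boolP (has (fun z => `|y - z| < d) rs).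
  by exists z => //; exact: rs_root.
move: Ft; rewrite (_ : F.[y] - t = (F - t%:P).[y]); last by rewrite !hornerE.
rewrite Ers hornerZ horner_prod normrM lFt ltr_pM2l ?normr_gt0 ?lead_coef_eq0 //.
rewrite normr_prod -srs real_ltNge ?ger0_real ?prodr_ge0 ?exprn_ge0 ?(ltW d0) //.
case/negP; rewrite -[size rs]card_ord -prodr_const.
rewrite (big_nth 0) big_mkord; apply: ler_prod => i _; rewrite (ltW d0) /= hornerXsubC.
by have := far _ (mem_nth 0 (ltn_ord i)); rewrite -real_leNgt ?normr_real ?gtr0_real.
Qed.

(** This is (F(x) - F(y)) / (x - y) with the division carried out monomial by monomial, so that it
    is a polynomial in both variables and makes sense on the diagonal. *)
Definition divided_difference F x y : K :=
  \sum_(i < size F) F`_i * \sum_(j < i) x ^+ (i.-1 - j) * y ^+ j.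

Lemma divided_differenceE F x y :
  F.[x] - F.[y] = (x - y) * divided_difference F x y.
Proof.
rewrite !horner_coef -sumrB mulr_sumr; apply: eq_bigr => i _.
by rewrite mulrCA -subrXX mulrBr.
Qed.

Lemma divided_difference_diag F x : divided_difference F x x = F^`().[x].
Proof.
rewrite -[in RHS](coefK F) poly_def raddf_sum /= horner_sum.
apply: eq_bigr => i _; rewrite derivZ derivXn hornerZ hornerMn hornerXn.
congr (_ * _); rewrite (eq_bigr (fun=> x ^+ i.-1)) => [|j _].
  by rewrite sumr_const card_ord.
by rewrite -exprD subnK // -ltnS (ltn_predK (ltn_ord j)) ltn_ord.
Qed.

Lemma divided_difference_differentiable F (z : K * K) :
  differentiable (fun z : K * K => divided_difference F z.1 z.2) z.
Proof.
have d1 : differentiable (fst : K * K -> K) z.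
  by apply: linear_differentiable => ?; exact: cvg_fst.
have d2 : differentiable (snd : K * K -> K) z.
  by apply: linear_differentiable => ?; exact: cvg_snd.
apply: fun_sum_differentiable => i; apply: differentiableM => //.
apply: fun_sum_differentiable => j.
by apply: differentiableM; exact: fun_exp_differentiable.
Qed.

(** The divided difference equals F'(x0) at (x0, x0), hence is nonzero on a ball around it: this
    gives injectivity of F there. [exists_root_near] gives surjectivity onto a ball around 0 and,
    used again around [h t], the continuity of the inverse [h]. *)
Lemma poly_local_inverse F x0 : F.[x0] = 0 -> F^`().[x0] != 0 ->
  exists (B W : set K) (h : K -> K),
    [/\ open B /\ B x0, open W /\ W 0,
        forall t, W t -> [/\ B (h t), F.[h t] = t & differentiable h t] &
        forall x, B x -> W F.[x] -> h F.[x] = x].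
Proof.
move=> Fx0 dFx0.
have sF : (1 < size F)%N.
  rewrite ltnNge; apply/negP => /size1_polyC FC; move: dFx0.
  by rewrite FC derivC horner0 eqxx.
have F0 : F != 0 by rewrite -size_poly_gt0 (ltn_trans _ sF).
have : \forall z \near (x0, x0), divided_difference F z.1 z.2 != 0.
  apply: (open_nbhs_nbhs (conj (open_differentiable_neq0
    (divided_difference_differentiable F)) _)) => /=.
  by rewrite divided_difference_diag.
case=> -[P1 P2] /= [/nbhs_ballP[r1 /= r10 rP1] /nbhs_ballP[r2 /= r20 rP2]] P12.
have [r [r0 rr1 rr2]] := exists_pos_le2 r10 r20.
pose B := ball x0 r.
have Qn0 x y : B x -> B y -> divided_difference F x y != 0.
  move=> Bx By; apply: (P12 (x, y)); split => /=.
    by apply: rP1; exact: (le_ball rr1).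
  by apply: rP2; exact: (le_ball rr2).
have Finj x y : B x -> B y -> F.[x] = F.[y] -> x = y.
  move=> Bx By /eqP; rewrite -subr_eq0 divided_differenceE mulf_eq0.
  by rewrite (negPf (Qn0 _ _ Bx By)) orbF subr_eq0 => /eqP.
pose lc := `|lead_coef F|; pose m := (size F).-1.
have lc0 : 0 < lc by rewrite normr_gt0 lead_coef_eq0.
have rad0 (d : K) : 0 < d -> 0 < lc * d ^+ m by move=> d0; rewrite mulr_gt0 ?exprn_gt0.
(* The radius is the bound of [exists_root_near] for distance [r], so every [t] in [W] has a
   preimage in [B]. *)
pose W : set K := ball 0 (lc * r ^+ m).
pose h t := xget 0 [set z | B z /\ F.[z] = t].
have hP t : W t -> B (h t) /\ F.[h t] = t.
  rewrite /W -ball_normE /= sub0r normrN => Wt.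
  apply: (@xgetPex _ _ [set z | B z /\ F.[z] = t]).
  have [z zx0 Fz] : exists2 z, `|x0 - z| < r & F.[z] = t.
    by apply: exists_root_near => //; rewrite Fx0 sub0r normrN.
  by exists z; split => //; rewrite /B -ball_normE.
have oB : open B by exact: ball_open.
have oW : open W by apply: ball_open; exact: rad0.
have hcont t : W t -> {for t, continuous h}.
  move=> Wt; have [Bht Fht] := hP t Wt.
  apply/(@cvgrPdist_lt _ _ _ (nbhs t)) => e e0.
  have /nbhs_ballP[d /= d0 dB] : nbhs (h t) B by exact: open_nbhs_nbhs.
  (* Below [d] the root found near [h t] stays in [B], where injectivity identifies it with [h s];
     below [e] it is close enough for continuity. *)
  have [d' [d'0 d'd d'e]] := exists_pos_le2 d0 e0.
  near=> s.
  have Ws : W s by near: s; exact: open_nbhs_nbhs.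
  have [Bhs Fhs] := hP s Ws.
  have [z zd Fz] : exists2 z, `|h t - z| < d' & F.[z] = s.
    apply: exists_root_near => //; rewrite Fht; near: s.
    have := nbhsx_ballx t _ (rad0 _ d'0).
    by rewrite -ball_normE.
  suff <- : z = h s by exact: lt_le_trans zd d'e.
  apply: Finj => //; last by rewrite Fhs.
  by apply: dB; rewrite -ball_normE /=; exact: lt_le_trans zd d'd.
exists B, W, h; split.
- by split => //; exact: ballxx.
- by split => //; apply: ballxx; exact: rad0.
- move=> t Wt; have [Bht Fht] := hP t Wt; split => //.
  apply/derivable1_diffP; apply/cvg_ex.
  exists (divided_difference F (h t) (h t))^-1.
  have shift_cvg : (h (s + t)) @[s --> 0^'] --> h t.
    by apply/(continuous_withinNshiftx h t); exact: hcont.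
  (* Since F(h(s + t)) - F(h(t)) = s, the difference quotient of [h] is exactly the inverse of the
     divided difference, whose limit follows from the continuity of [h]. *)
  have : (divided_difference F (h (s + t)) (h t))^-1 @[s --> 0^'] -->
     (divided_difference F (h t) (h t))^-1.
    apply: cvgV; first exact: Qn0.
    apply: (cvg_comp (fun s => (h (s + t), h t))
        (fun z : K * K => divided_difference F z.1 z.2)); last first.
      exact: (differentiable_continuous (divided_difference_differentiable F (h t, h t))).
    exact: (cvg_pair shift_cvg (cvg_cst (h t))).
  apply: cvg_trans; apply: near_eq_cvg; near=> s.
  have s0 : s != 0 by near: s; exact: nbhs_dnbhs_neq.
  have Wst : W (s + t).
    near: s.
    have : (s + t) @[s --> (0:K)^'] --> t.
      by apply/(continuous_withinNshiftx id t).
    by move=> /(_ W); apply; exact: open_nbhs_nbhs.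
  have [Bhst Fhst] := hP _ Wst.
  have := divided_differenceE F (h (s + t)) (h t).
  rewrite Fhst Fht addrK => Es.
  have s1 : s *: (1 : K) = s by exact: mulr1.
  rewrite /= s1 [RHS]/(_ * _); apply: (mulfI s0).
  by rewrite mulVKf // [X in X * _]Es mulfK // Qn0.
- by move=> x Bx WFx; have [? ?] := hP _ WFx; apply: Finj.
Unshelve. all: by end_near. Qed.

End PolynomialLocalInverse.

(** * The hypersurfaces u w = F(x) *)

Section RowFunctions.
Variable K : numFieldType.

Lemma co_row n (s : nat -> K) k :
  (k < n.+1)%N -> co (\row_(i < n.+1) s i) k = s k.
Proof. by move=> kn; rewrite mxE inordK. Qed.

Lemma row_coP n (v w : 'rV[K]_n.+1) :
  (forall k, (k < n.+1)%N -> co v k = co w k) -> v = w.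
Proof.
move=> vw; apply/rowP => j; rewrite -[j]inord_val; exact: vw.
Qed.

Lemma mkrow_differentiable (V : normedModType K) m (s : V -> nat -> K) x :
  (forall k, (k < m)%N -> differentiable (fun y => s y k) x) ->
  differentiable (fun y => \row_(i < m) s y i) x.
Proof.
move=> ds; apply: row_differentiable => i.
rewrite (_ : (fun y => _) = (fun y => s y i)); first exact: ds.
by apply/funext => y; rewrite mxE.
Qed.

Lemma seqrow_differentiable (V : normedModType K) m (s : V -> seq K) x :
  (forall k, (k < m)%N -> differentiable (fun y => (s y)`_k) x) ->
  differentiable (fun y => \row_(i < m) (s y)`_i) x.
Proof. exact: mkrow_differentiable. Qed.

Lemma co_seqrow n (s : seq K) k : (k < n.+1)%N -> co (\row_(i < n.+1) s`_i) k = s`_k.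
Proof. exact: co_row. Qed.

Lemma co_differentiable n k (v : 'rV[K]_n.+1) :
  differentiable (fun w : 'rV[K]_n.+1 => co w k : K) v.
Proof. exact: differentiable_coord. Qed.

End RowFunctions.

Section Hypersurface.
Variable K : numClosedFieldType.
Implicit Types (F E : {poly K}).

Definition hypersurface F : set 'rV[K]_3 :=
  [set v | co v 1 * co v 2 = F.[co v 0]].

(** Where u <> 0 the equation solves for w = F(x) / u, a graph over (x, u). *)
Lemma hypersurface_smooth_neq0 F p : hypersurface F p -> co p 1 != 0 ->
  germ_iso (hypersurface F) p [set: 'rV[K]_2] 0.
Proof.
move=> Hp p1.
pose f (v : 'rV[K]_3) : 'rV[K]_2 := \row_i [:: co v 0; co v 1]`_i.
pose g (w : 'rV[K]_2) : 'rV[K]_3 :=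
  \row_i [:: co w 0; co w 1; F.[co w 0] / co w 1]`_i.
apply: (@germ_iso_trans _ _ _ _ _ _ setT (f p)); last exact: germ_iso_setT_translate.
exists [set v | co v 1 != 0], [set w | co w 1 != 0], f, g; split => //.
- split; split.
  + by apply: open_differentiable_neq0 => v; exact: co_differentiable.
  + move=> v _; apply: seqrow_differentiable; case=> [|[|]] // _;
    exact: co_differentiable.
  + by apply: open_differentiable_neq0 => v; exact: co_differentiable.
  + move=> w w1; apply: seqrow_differentiable; case=> [|[|[|]]] // _ /=;
      try exact: co_differentiable.
    apply: differentiableM; first exact/fun_horner_differentiable/co_differentiable.
    apply: differentiableV => //; exact: co_differentiable.
- move=> v [Hv v1]; split; first by split => //=; rewrite /f co_seqrow.
  apply: row_coP; case=> [|[|[|]]] // _; rewrite /g /f !co_seqrow //=.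
  by rewrite -Hv mulrC mulKf.
- move=> w [_ w1]; split.
    by split; rewrite /hypersurface /= /g !co_seqrow //= mulrC divfK.
  by apply: row_coP; case=> [|[|]] // _; rewrite /g /f !co_seqrow.
Qed.

Lemma hypersurface_swap F p : hypersurface F p ->
  germ_iso (hypersurface F) p
    (hypersurface F) (\row_i [:: co p 0; co p 2; co p 1]`_i).
Proof.
move=> Hp; pose s (v : 'rV[K]_3) : 'rV[K]_3 := \row_i [:: co v 0; co v 2; co v 1]`_i.
have ds v : differentiable s v.
  by apply: seqrow_differentiable; case=> [|[|[|]]] // _; exact: co_differentiable.
have Hs v : hypersurface F v -> hypersurface F (s v) /\ s (s v) = v.
  move=> Hv; split; first by rewrite /hypersurface /= !co_seqrow //= mulrC.
  by apply: row_coP; case=> [|[|[|]]] // _; rewrite /s !co_seqrow.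
exact: (@germ_iso_global _ _ _ _ _ _ _ s s).
Qed.

(** At a simple root the equation solves for x = h(u w), a graph over (u, w). *)
Lemma hypersurface_smooth_root F p : hypersurface F p ->
  co p 1 = 0 -> co p 2 = 0 -> F^`().[co p 0] != 0 ->
  germ_iso (hypersurface F) p [set: 'rV[K]_2] 0.
Proof.
move=> Hp p1 p2 dF.
have F0 : F.[co p 0] = 0 by rewrite -Hp p1 mul0r.
have [B [W [h [[oB Bp] [oW W0] hW hB]]]] := poly_local_inverse F0 dF.
pose f (v : 'rV[K]_3) : 'rV[K]_2 := \row_i [:: co v 1; co v 2]`_i.
pose g (w : 'rV[K]_2) : 'rV[K]_3 :=
  \row_i [:: h (co w 0 * co w 1); co w 0; co w 1]`_i.
have dprod n (v : 'rV[K]_n.+1) i j :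
    differentiable (fun v : 'rV[K]_n.+1 => co v i * co v j : K) v.
  by apply: differentiableM; exact: co_differentiable.
apply: (@germ_iso_trans _ _ _ _ _ _ setT (f p)); last exact: germ_iso_setT_translate.
exists ([set v | B (co v 0)] `&` [set v | W (co v 1 * co v 2)]),
  [set w | W (co w 0 * co w 1)], f, g; split.
- by split => //; split => //; split => //=; rewrite p1 mul0r.
- split; split.
  + by apply: openI; apply: open_preimage_fun => // v; exact: co_differentiable.
  + move=> v _; apply: seqrow_differentiable; case=> [|[|]] // _;
    exact: co_differentiable.
  + by apply: open_preimage_fun.
  + move=> w Ww; apply: seqrow_differentiable; case=> [|[|[|]]] // _ /=;
      try exact: co_differentiable.
    have [_ _ dh] := hW _ Ww.
    exact: (differentiable_comp (dprod _ w 0 1) dh).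
- move=> v [Hv [Bv Wv]]; split; first by split => //=; rewrite /f !co_seqrow.
  apply: row_coP; case=> [|[|[|]]] // _; rewrite /g /f !co_seqrow //=.
  by rewrite Hv hB // -Hv.
- move=> w [_ Ww]; have [Bhw Fhw _] := hW _ Ww; split.
    by split; [|split]; rewrite /hypersurface /= /g !co_seqrow.
  by apply: row_coP; case=> [|[|]] // _; rewrite /g /f !co_seqrow.
Qed.

Lemma hypersurface_smooth F p : hypersurface F p ->
  [|| co p 1 != 0, co p 2 != 0 | F^`().[co p 0] != 0] ->
  germ_iso (hypersurface F) p [set: 'rV[K]_2] 0.
Proof.
move=> Hp; have [p1|p1] := eqVneq (co p 1) 0; last first.
  by move=> _; exact: hypersurface_smooth_neq0.
have [p2|p2] := eqVneq (co p 2) 0; first by move=> /=; exact: hypersurface_smooth_root.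
move=> _; apply: (germ_iso_trans (hypersurface_swap Hp)).
have [_ [_ [_ [_ [[[_ _] _] _ _ _]]]]] := hypersurface_swap Hp.
apply: hypersurface_smooth_neq0; last by rewrite co_seqrow.
by rewrite /hypersurface /= !co_seqrow //= mulrC.
Qed.

Lemma germ_iso_hypersurface_smooth m (X : set 'rV[K]_m) p F q :
  germ_iso X p (hypersurface F) q ->
  [|| co q 1 != 0, co q 2 != 0 | F^`().[co q 0] != 0] ->
  germ_iso X p [set: 'rV[K]_2] 0.
Proof.
move=> iso cond; apply: (germ_iso_trans iso).
by apply: hypersurface_smooth => //; exact: germ_iso_mem iso.
Qed.

Lemma hypersurface_nonsmooth k d (q : 'rV[K]_d) : (1 < k)%N ->
  ~ germ_iso (hypersurface 'X^k) 0 [set: 'rV[K]_d] q.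
Proof.
move=> k1; apply: (@germ_nonsmooth _ _ _ 2) => //.
- move=> U oU U0.
  (* Nonzero points of the u-axis are smooth and tend to the origin. *)
  pose c (t : K) : 'rV[K]_3 := \row_i [:: 0; t; 0]`_i.
  have dc : differentiable c 0.
    apply: seqrow_differentiable; case=> [|[|[|]]] //= _; exact: differentiable_cst.
  have c0 : c 0 = 0.
    by apply: row_coP; case=> [|[|[|]]] //= _; rewrite co_seqrow // mxE.
  have : \forall t \near (0 : K)^', t != 0 /\ U (c t).
    near=> t; split; near: t; first exact: nbhs_dnbhs_neq.
    apply: cvg_within; apply: (differentiable_continuous dc).
    by rewrite c0; exact: open_nbhs_nbhs.
  move=> /filter_ex [t [t0 Uct]].
  have Hct : hypersurface 'X^k (c t).
    by rewrite /hypersurface /= !co_seqrow //= mulr0 hornerXn expr0n gtn_eqF // ltnW.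
  exists (c t); split => //; apply: hypersurface_smooth => //.
  by rewrite !co_seqrow //= t0.
- move=> M fixM.
  have tan3 (s : nat -> K -> K) (v : 'rV[K]_3) :
      (forall t, s 1%N t * s 2 t = s 0%N t ^+ k) ->
      (forall i, (i < 3)%N ->
        [/\ s i 0 = 0, differentiable (s i) 0 & 'D_1 (s i) 0 = co v i]) ->
      v *m M = v.
    move=> Hs ds; apply: fixM; exists (fun t => \row_i s i t).
    have drow : differentiable (fun t => \row_(i < 3) s i t) 0.
      by apply: (@mkrow_differentiable _ _ _ (fun t i => s i t)) => i /ds[].
    split => //.
    + by apply: row_coP => i i3; rewrite (co_row (fun i => s i 0)) // mxE; have [] := ds i i3.
    + by move=> t; rewrite /hypersurface /= !(co_row (fun i => s i t)) // hornerXn.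
    + apply: row_coP => i i3; rewrite derive_coord //.
      rewrite (_ : (fun t => _) = s i); first by have [] := ds i i3.
      by apply/funext => t; rewrite (co_row (fun i => s i t)).
  have dX j : 'D_1 (fun t : K => t ^+ j.+1) 0 = (j == 0%N)%:R.
    by rewrite exp_derive; case: j => [|j] /=;
      rewrite ?expr0 ?expr0n /= ?scale1r ?scaler0 ?scale0r.
  have dX' j : differentiable (fun t : K => t ^+ j) 0.
    exact: fun_exp_differentiable.
  pose e j : 'rV[K]_3 := delta_mx 0 (inord j).
  have coe j l : (j < 3)%N -> (l < 3)%N -> co (e j) l = (l == j)%:R.
    move=> j3 l3; rewrite mxE eqxx /= -val_eqE /= !inordK //.
  have e1 : e 1%N *m M = e 1%N.
    apply: (tan3 (fun j t => [:: 0; t; 0]`_j)) => [t|].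
      by rewrite /= mulr0 expr0n gtn_eqF // ltnW.
    by case=> [|[|[|]]] // _ /=; rewrite coe // ?derive_cst ?derive_id; split.
  have e2 : e 2 *m M = e 2.
    apply: (tan3 (fun j t => [:: 0; 0; t]`_j)) => [t|].
      by rewrite /= mul0r expr0n gtn_eqF // ltnW.
    by case=> [|[|[|]]] // _ /=; rewrite coe // ?derive_cst ?derive_id; split.
  have e0 : e 0%N *m M = e 0%N.
    (* the tangent at 0 of the curve (t, t^(k-1), t) *)
    have : (e 0%N + (k == 2)%:R *: e 1%N + e 2) *m M =
           e 0%N + (k == 2)%:R *: e 1%N + e 2.
      apply: (tan3 (fun j t => [:: t; t ^+ k.-1; t]`_j)) => [t|].
        by rewrite /= -exprSr prednK // ltnW.
      case=> [|[|[|]]] // _ /=; rewrite mxE [X in X + _]mxE [X in _ + X + _]mxE !coe //=;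
        rewrite ?mulr0 ?mulr1 ?addr0 ?add0r ?derive_id; split => //.
        by rewrite expr0n -subn1 subn_eq0 leqNgt k1.
      by rewrite -(subnKC k1) /= dX; case: (k - 2)%N.
    (* By linearity, the contributions of the already fixed vectors [e 1] and [e 2] cancel. *)
    by rewrite !mulmxDl -scalemxAl e1 e2 => /addIr /addIr.
  apply/row_matrixP => j; rewrite row1 rowE -[j]inord_val.
  by case: j => -[|[|[|]]] //= _.
Unshelve. all: by end_near. Qed.

End Hypersurface.

(** * The cone over the rational normal curve *)

Section RationalNormalCone.
Variable K : numClosedFieldType.

(** The 2x2 minors of consecutive entries vanish on the parametrized cone, hence on its closure.
    They determine the vector from its first two entries when the first is nonzero, and otherwise
    kill all entries but the last. *)
Lemma rnc_coneP n (a : nat -> K) : (1 < n)%N ->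
  rnc_cone (\row_(k < n) a k) <->
  (exists c x, forall k, (k < n)%N -> a k = c * x ^+ k) \/
  (forall k, (k < n.-1)%N -> a k = 0).
Proof.
move=> n1; split.
- move=> cl_a.
  have minor i j : (i.+1 < n)%N -> (j.+1 < n)%N -> a i * a j.+1 = a i.+1 * a j.
    move=> hi hj; apply/eqP; rewrite -subr_eq0; apply/negPn/negP => minor0.
    pose phi (v : 'rV[K]_n) : K :=
      v 0 (Ordinal (ltnW hi)) * v 0 (Ordinal hj) -
      v 0 (Ordinal hi) * v 0 (Ordinal (ltnW hj)).
    have dphi v : differentiable phi v.
      apply: differentiableB; apply: differentiableM; exact: differentiable_coord.
    (* Nonvanishing of the minor is an open condition, so it would also hold at some point c (1, x,
       ...) of the cone. *)
    have [] := cl_a [set v | phi v != 0].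
      apply: open_nbhs_nbhs; split; first exact: open_differentiable_neq0.
      by rewrite /= /phi !mxE.
    move=> v [[c [x ->]]] /=; rewrite /phi !mxE /= !exprS.
    by rewrite (_ : _ - _ = 0) ?eqxx //; ring.
  have [a0|a0] := eqVneq (a 0%N) 0; [right|left].
    elim=> [//|k ih] hk; have k2 : (k.+2 < n)%N by rewrite -ltn_predRL.
    have := minor k k.+1 (ltnW k2) k2; rewrite ih 1?ltnW // mul0r => /esym/eqP.
    by rewrite mulf_eq0 orbb => /eqP.
  exists (a 0%N), (a 1%N / a 0%N); elim=> [|k ih] hk; first by rewrite expr0 mulr1.
  apply: (mulfI a0); rewrite minor // ih ?(ltnW hk) // exprS.
  by field.
- move=> [[c [x ax]]|a0].
    apply: subset_closure; exists c, x; apply/rowP => k.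
    by rewrite !mxE ax.
  (* (0, ..., 0, a) is the limit of a y^(n-1) (1, 1/y, ..., 1/y^(n-1)) as y -> 0. *)
  move=> B Bv; pose r (y : K) : 'rV[K]_n := \row_k (a n.-1 * y ^+ (n.-1 - k)).
  have dr : differentiable r 0.
    apply: (@mkrow_differentiable _ _ _ (fun (y : K) k => a n.-1 * y ^+ (n.-1 - k))) => k _.
    by apply: differentiableM => //; exact: fun_exp_differentiable.
  have r0 : r 0 = \row_k a k.
    apply/rowP => k; rewrite !mxE expr0n subn_eq0.
    case: leqP => [nk|kn]; last by rewrite mulr0 a0.
    rewrite mulr1; congr a; apply/eqP; rewrite eqn_leq nk -ltnS prednK ?ltn_ord //.
    exact: ltnW.
  have : \forall y \near (0 : K)^', y != 0 /\ B (r y).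
    near=> y; split; near: y; first exact: nbhs_dnbhs_neq.
    by apply: cvg_within; apply: (differentiable_continuous dr); rewrite r0.
  move=> /filter_ex [y [y0 Bry]]; exists (r y); split => //.
  exists (a n.-1 * y ^+ n.-1), y^-1; apply/rowP => k; rewrite !mxE.
  have kn : (k <= n.-1)%N by rewrite -ltnS prednK ?ltn_ord // ltnW.
  by rewrite -mulrA -[in y ^+ n.-1](subnK kn) exprD exprVn mulfK // expf_neq0.
Unshelve. all: by end_near. Qed.

(** In characteristic zero the integers below [size p] are distinct, too many roots for a nonzero
    [p]. *)
Lemma poly_eq0_horner (p : {poly K}) : (forall x, p.[x] = 0) -> p = 0.
Proof.
move=> px; apply/eqP; apply/negPn/negP => p0.
have : (size [seq i%:R : K | i <- iota 0 (size p)] < size p)%N.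
  apply: max_poly_roots => //; first by apply/allP => x _; apply/eqP; exact: px.
  by rewrite map_inj_uniq ?iota_uniq // => i j /eqP; rewrite eqr_nat => /eqP.
by rewrite size_map size_iota ltnn.
Qed.

Lemma rnc_cone_nonsmooth n d (q : 'rV[K]_d) : (2 < n)%N ->
  ~ germ_iso (@rnc_cone K n) 0 [set: 'rV[K]_d] q.
Proof.
case: n => // m m2; apply: (@germ_nonsmooth _ _ _ 2) => //.
- move=> U oU U0.
  (* As [0 ^+ 0] is 1, this is t times the first basis vector, the ruling x = 0 of the cone. *)
  pose r (t : K) : 'rV[K]_m.+1 := \row_k (t * 0 ^+ k).
  have dr : differentiable r 0.
    apply: (@mkrow_differentiable _ _ _ (fun (t : K) k => t * 0 ^+ k)) => k _.
    by apply: differentiableM => //; exact: differentiable_cst.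
  have r0 : r 0 = 0 by apply/rowP => k; rewrite !mxE mul0r.
  have : \forall t \near (0 : K)^', t != 0 /\ U (r t).
    near=> t; split; near: t; first exact: nbhs_dnbhs_neq.
    apply: cvg_within; apply: (differentiable_continuous dr).
    by rewrite r0; exact: open_nbhs_nbhs.
  move=> /filter_ex [t [t0 Urt]].
  have Crt : @rnc_cone K m.+1 (r t).
    by apply/(rnc_coneP (fun k => t * 0 ^+ k)); [exact: ltnW|left; exists t, 0].
  exists (r t); split => //.
  (* Away from a vanishing first coordinate, c = v_0 and x = v_1 / v_0 recover the parameters of the
     cone. *)
  pose f (v : 'rV[K]_m.+1) : 'rV[K]_2 := \row_i [:: co v 0; co v 1 / co v 0]`_i.
  pose g (w : 'rV[K]_2) : 'rV[K]_m.+1 := \row_k (co w 0 * co w 1 ^+ k).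
  have cog w k : (k < m.+1)%N -> co (g w) k = co w 0 * co w 1 ^+ k.
    exact: (co_row (fun k => co w 0 * co w 1 ^+ k)).
  apply: (@germ_iso_trans _ _ _ _ _ _ setT (f (r t))); last exact: germ_iso_setT_translate.
  exists [set v | co v 0 != 0], [set w | co w 0 != 0], f, g; split.
  + by split => //; split => //=; rewrite (co_row (fun k => t * 0 ^+ k)) // expr0 mulr1.
  + split; split.
    * by apply: open_differentiable_neq0 => v; exact: co_differentiable.
    * move=> v v0; apply: seqrow_differentiable; case=> [|[|]] // _ /=;
        first exact: co_differentiable.
      apply: differentiableM; first exact: co_differentiable.
      apply: differentiableV => //; exact: co_differentiable.
    * by apply: open_differentiable_neq0 => v; exact: co_differentiable.
    * move=> w w0; apply: (@mkrow_differentiable _ _ _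
        (fun (w : 'rV[K]_2) k => co w 0 * co w 1 ^+ k)) => k _.
      apply: differentiableM; first exact: co_differentiable.
      apply: fun_exp_differentiable; exact: co_differentiable.
  + move=> v [Cv v0]; split; first by split => //=; rewrite /f co_seqrow.
    have : rnc_cone (\row_(k < m.+1) co v k).
      rewrite (_ : \row_k _ = v) //; apply: row_coP => k hk.
      exact: (co_row (fun k => co v k)).
    move=> /(rnc_coneP (fun k => co v k) (ltnW m2)) [|vk].
      move=> [c [x vk]]; apply: row_coP => k hk; rewrite cog // /f !co_seqrow //=.
      have c0 : co v 0 = c by rewrite vk // expr0 mulr1.
      have cn0 : c != 0 by rewrite -c0.
      rewrite c0 (vk 1%N) ?(vk k) //; last exact: ltnW.
      by rewrite expr1 [c * x]mulrC mulfK.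
    by move: v0; rewrite /= vk ?eqxx //=; exact: ltnW.
  + move=> w [_ w0]; split.
      split => /=; last by rewrite cog // expr0 mulr1.
      apply/(rnc_coneP (fun k => co w 0 * co w 1 ^+ k)); first exact: ltnW.
      by left; exists (co w 0), (co w 1).
    apply: row_coP; case=> [|[|]] // _; rewrite /f co_seqrow //= !cog ?(ltnW m2) //.
      by rewrite expr0 mulr1.
    by rewrite expr0 mulr1 expr1 [co w 0 * _]mulrC mulfK.
- move=> M fixM.
  (* The lines of the cone span K^(m+1): a linear form vanishing on all of them is a
     polynomial vanishing everywhere. *)
  have fix_mono (x : K) : (\row_(k < m.+1) x ^+ k) *m M = \row_(k < m.+1) x ^+ k.
    apply: fixM; exists ( *:%R ^~ (\row_(k < m.+1) x ^+ k)); split => //.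
    + by rewrite scale0r.
    + move=> t; rewrite (_ : _ *: _ = \row_k (t * x ^+ k)).
        apply/(rnc_coneP (fun k => t * x ^+ k)); first exact: ltnW.
        by left; exists t, x.
      by apply/rowP => k; rewrite !mxE.
    + by rewrite deriveE // diff_val scale1r.
  apply/eqP; rewrite -subr_eq0; apply/eqP/matrixP => i j; rewrite mxE.
  pose p := \poly_(k < m.+1) (M - 1%:M) (inord k) j.
  suff /polyP/(_ i) : p = 0.
    by rewrite coef_poly ltn_ord coef0 inord_val !mxE.
  apply: poly_eq0_horner => x; rewrite horner_poly.
  have := congr1 (fun v : 'rV[K]_m.+1 => v 0 j) (fix_mono x).
  move/eqP; rewrite -subr_eq0 -{2}[\row_k _]mulmx1 => /eqP E.
  transitivity (((\row_(k < m.+1) x ^+ k) *m (M - 1%:M)) 0 j).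
    by rewrite mxE; apply: eq_bigr => k _; rewrite mxE inord_val mulrC.
  by rewrite mulmxBr mxE [X in _ + X]mxE E.
Unshelve. all: by end_near. Qed.

End RationalNormalCone.

(** * Reduction of the charts to surfaces in 3-space and to the Du Val equation *)

Section Models.
Variable K : numClosedFieldType.
Implicit Types (F E G : {poly K}).

(* The shape of the two charts of T that cover the complement of l_infty: with
   x = w_i0, the first n-1 coordinates are powers of x, the last two are u and w. *)
Definition hypersurface_over n (e : nat -> nat) (i0 : nat) F : set 'rV[K]_n.+1 :=
  [set w | (forall k, (k < n.-1)%N -> co w k = co w i0 ^+ e k) /\
           co w n.-1 * co w n = F.[co w i0]].

(** The first n-1 coordinates are determined by the one at [i0], so forgetting the others loses
    nothing; [e i0 = 1] makes the condition at [i0] itself automatic. *)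
Lemma germ_iso_hypersurface_over n e i0 F (w : 'rV[K]_n.+1) :
  (i0 < n.-1)%N -> e i0 = 1%N -> hypersurface_over e i0 F w ->
  germ_iso (@hypersurface_over n e i0 F) w (hypersurface F)
    (\row_i [:: co w i0; co w n.-1; co w n]`_i).
Proof.
move=> hi0 ei0 Hw; have n0 : (0 < n)%N by case: n hi0 {w Hw}.
pose f (w : 'rV[K]_n.+1) : 'rV[K]_3 := \row_i [:: co w i0; co w n.-1; co w n]`_i.
pose s (v : 'rV[K]_3) k :=
  if (k < n.-1)%N then co v 0 ^+ e k else if k == n then co v 2 else co v 1.
pose g (v : 'rV[K]_3) : 'rV[K]_n.+1 := \row_k s v k.
have cog v k : (k < n.+1)%N -> co (g v) k = s v k by exact: co_row.
have gi0 v : co (g v) i0 = co v 0.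
  by rewrite cog /s ?hi0 ?ei0 ?expr1 // (leq_trans hi0) // (leq_trans (leq_pred n)).
have gn1 v : co (g v) n.-1 = co v 1.
  by rewrite cog /s ?ltnn ?ltnS ?leq_pred //; rewrite -[in X in _ == X](prednK n0) ltn_eqF.
have gn v : co (g v) n = co v 2.
  by rewrite cog /s // ltnNge leq_pred /= eqxx.
apply: (@germ_iso_global _ _ _ _ _ _ _ f g) => //.
- by move=> v; apply: seqrow_differentiable; case=> [|[|[|]]] // _;
    exact: co_differentiable.
- move=> v; apply: (@mkrow_differentiable _ _ _ s) => k _; rewrite /s.
  case: (k < n.-1)%N; first exact/fun_exp_differentiable/co_differentiable.
  by case: (k == n); exact: co_differentiable.
- move=> v [vk vF]; split; first by rewrite /hypersurface /= /f !co_seqrow.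
  apply: row_coP => k kn; rewrite cog // /s /f !co_seqrow //=.
  case: ifP => [kn1|]; first by rewrite (vk k).
  case: eqP => [->//|/eqP kn' kn1]; congr (v 0 (inord _)).
  by apply/eqP; rewrite eqn_leq leqNgt kn1 /= -ltnS prednK // ltn_neqAle kn' -ltnS.
- move=> v Hv; split.
    split; last by rewrite gi0 gn1 gn.
    move=> k kn; rewrite gi0 cog /s ?kn // (leq_trans kn) //.
    by rewrite (leq_trans (leq_pred n)).
  by apply: row_coP; case=> [|[|[|]]] // _; rewrite /f co_seqrow //= ?gi0 ?gn1 ?gn.
Qed.

Lemma germ_iso_hypersurface_unit F E : E.[0] != 0 -> F.[0] = 0 ->
  germ_iso (hypersurface (F * E)) 0 (hypersurface F) 0.
Proof.
move=> E0 F0.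
pose f (v : 'rV[K]_3) : 'rV[K]_3 := \row_i [:: co v 0; co v 1 / E.[co v 0]; co v 2]`_i.
pose g (v : 'rV[K]_3) : 'rV[K]_3 := \row_i [:: co v 0; co v 1 * E.[co v 0]; co v 2]`_i.
have oU : open [set v : 'rV[K]_3 | E.[co v 0] != 0].
  apply: open_differentiable_neq0 => v.
  exact/fun_horner_differentiable/co_differentiable.
exists [set v | E.[co v 0] != 0], [set v | E.[co v 0] != 0], f, g; split.
- split.
    by split; rewrite /hypersurface /= !mxE // mulr0 hornerM F0 mul0r.
  by apply: row_coP; case=> [|[|[|]]] // _; rewrite /f co_seqrow //= !mxE // mul0r.
- split; split => //.
  + move=> v v0; apply: seqrow_differentiable; case=> [|[|[|]]] // _ /=;
      try exact: co_differentiable.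
    apply: differentiableM; first exact: co_differentiable.
    apply: differentiableV => //.
    exact/fun_horner_differentiable/co_differentiable.
  + move=> v v0; apply: seqrow_differentiable; case=> [|[|[|]]] // _ /=;
      try exact: co_differentiable.
    apply: differentiableM; first exact: co_differentiable.
    exact/fun_horner_differentiable/co_differentiable.
- move=> v [Hv v0]; split.
    split; rewrite /hypersurface /= /f !co_seqrow //=.
    by rewrite mulrAC Hv hornerM mulfK.
  apply: row_coP; case=> [|[|[|]]] // _; rewrite /g /f !co_seqrow //=.
  by rewrite divfK.
- move=> v [Hv v0]; split.
    split; rewrite /hypersurface /= /g !co_seqrow //=.
    by rewrite mulrAC Hv hornerM.
  apply: row_coP; case=> [|[|[|]]] // _; rewrite /g /f !co_seqrow //=.
  by rewrite mulfK.
Qed.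

(** With u = x + i y and w = -x + i y one has u w = -(x^2 + y^2); the minus sign in w turns u w =
    z^(k+1) into the Du Val equation. *)
Lemma germ_iso_hypersurface_du_val k :
  germ_iso (hypersurface ('X^(k.+1) : {poly K})) 0 (@du_val_A K k) 0.
Proof.
pose f (v : 'rV[K]_3) : 'rV[K]_3 :=
  \row_i [:: (co v 1 - co v 2) / 2; (co v 1 + co v 2) / (2 * 'i); co v 0]`_i.
pose g (v : 'rV[K]_3) : 'rV[K]_3 :=
  \row_i [:: co v 2; co v 0 + 'i * co v 1; - co v 0 + 'i * co v 1]`_i.
have i0 : 'i != 0 :> K by exact: neq0Ci.
have i2 : 'i ^+ 2 = -1 :> K by exact: sqrCi.
have dC (a : K) (h : 'rV[K]_3 -> K) v : differentiable h v ->
    differentiable (fun v => a * h v) v.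
  by move=> dh; apply: differentiableM.
apply: (@germ_iso_global _ _ _ _ _ _ _ f g).
- move=> v; apply: seqrow_differentiable; case=> [|[|[|]]] // _ /=;
    try exact: co_differentiable.
    apply: differentiableM => //; apply: differentiableB; exact: co_differentiable.
  apply: differentiableM => //; apply: differentiableD; exact: co_differentiable.
- move=> v; apply: seqrow_differentiable; case=> [|[|[|]]] // _ /=;
    try exact: co_differentiable.
    by apply: differentiableD; [|apply: dC]; exact: co_differentiable.
  apply: differentiableD; last by apply: dC; exact: co_differentiable.
  apply: differentiableN; exact: co_differentiable.
- by rewrite /hypersurface /= !mxE mul0r hornerXn expr0n.
- by apply: row_coP; case=> [|[|[|]]] // _; rewrite /f co_seqrow //= !mxE ?subr0 ?addr0 ?mul0r.
- move=> v; rewrite /hypersurface /= hornerXn => Hv; split.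
    rewrite /du_val_A /= /f !co_seqrow //= -Hv.
    rewrite !exprMn !exprVn exprMn i2.
    by field.
  apply: row_coP; case=> [|[|[|]]] // _; rewrite /g /f !co_seqrow //=; field => //.
- move=> v; rewrite /du_val_A /= => Hv; split.
    rewrite /hypersurface /= /g !co_seqrow //= hornerXn.
    apply/eqP; rewrite -subr_eq0; apply/eqP; transitivity (- (0 : K)); last by rewrite oppr0.
    rewrite -Hv -[X in _ = - (_ + X + _)]mul1r -[X in X * _ ^+ 2]opprK -i2; ring.
  apply: row_coP; case=> [|[|[|]]] // _; rewrite /g /f !co_seqrow //=; field => //.
Qed.

End Models.

(** * Charts *)

Section Charts.
Variable K : numFieldType.

Lemma hpoint_coordP N (j : 'I_N) (z : 'rV[K]_N) :
  hpoint (delta_mx 0 j) z <-> z 0 j != 0 /\ forall i, i != j -> z 0 i = 0.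
Proof.
split=> [[z0 /andP[/sub_rVP[a za] _]]|[zj zi]].
  have a0 : a != 0 by apply: contraNneq z0 => a0; rewrite za a0 scale0r.
  rewrite za !mxE !eqxx mulr1; split => // i ij.
  by rewrite !mxE eqxx (negPf ij) mulr0.
have Ez : z = z 0 j *: delta_mx 0 j.
  apply/rowP => i; rewrite !mxE eqxx /=.
  by have [->|/zi] := eqVneq i j; rewrite ?mulr1 ?mulr0.
split; first by apply: contraNneq zj => ->; rewrite mxE.
by rewrite Ez; apply/eqmxP; exact: eqmx_scale.
Qed.

Lemma hpoint_coord_refl N (j : 'I_N) : hpoint (delta_mx 0 j : 'rV[K]_N) (delta_mx 0 j).
Proof.
apply/hpoint_coordP; split=> [|i ij]; first by rewrite mxE !eqxx oner_eq0.
by rewrite mxE eqxx (negPf ij).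
Qed.

Lemma hpoint_coord_neq N (i j : 'I_N) :
  i != j -> hpoint (delta_mx 0 i : 'rV[K]_N) <> hpoint (delta_mx 0 j).
Proof.
move=> ij E; have : hpoint (delta_mx 0 j : 'rV[K]_N) (delta_mx 0 i).
  by rewrite -E; exact: hpoint_coord_refl.
by move=> /hpoint_coordP[]; rewrite mxE [j == i]eq_sym (negPf ij) andbF eqxx.
Qed.

Definition unchart N (j : 'I_N.+1) (w : 'rV[K]_N) : 'rV[K]_N.+1 :=
  \row_i (if unlift j i is Some k then w 0 k else 1).

Lemma chartE N (j : 'I_N.+1) (z : 'rV[K]_N.+1) k :
  chart j z 0 k = z 0 (lift j k) / z 0 j.
Proof. by rewrite !mxE mulrC. Qed.

Lemma unchartK N (j : 'I_N.+1) (w : 'rV[K]_N) : chart j (unchart j w) = w.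
Proof.
by apply/rowP => k; rewrite chartE !mxE unlift_none liftK divr1.
Qed.

Lemma chartK N (j : 'I_N.+1) (z : 'rV[K]_N.+1) :
  z 0 j != 0 -> unchart j (chart j z) = (z 0 j)^-1 *: z.
Proof.
move=> zj; apply/rowP => i; rewrite !mxE.
by case: unliftP => [k ->|->]; rewrite ?chartE ?mulVf // mulrC.
Qed.

(** For a set stable under scaling, the chart image is a preimage under [unchart], so its equations
    are those of [X] with one coordinate set to 1. *)
Lemma chart_image N (j : 'I_N.+1) (X : set 'rV[K]_N.+1) :
  (forall c z, c != 0 -> X z -> X (c *: z)) ->
  chart j @` (X `&` [set z | z 0 j != 0]) = [set w | X (unchart j w)].
Proof.
move=> homX; apply/seteqP; split=> [w [z [Xz zj] <-]|w Xw] /=.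
  by rewrite chartK //; apply: homX => //; rewrite invr_neq0.
exists (unchart j w); last exact: unchartK.
by split => //=; rewrite mxE unlift_none oner_eq0.
Qed.

(** Only one coordinate of such a point is nonzero, so the chart chosen in [proj_germ_iso] is
    forced. The equivalence serves both to exhibit isomorphisms and to exclude them. *)
Lemma proj_germ_iso_coord N (j : 'I_N.+1) (X : set 'rV[K]_N.+1) p m
    (Y : set 'rV[K]_m) q :
  (forall c z, c != 0 -> X z -> X (c *: z)) -> hpoint (delta_mx 0 j) p ->
  proj_germ_iso X p Y q <-> germ_iso [set w | X (unchart j w)] 0 Y q.
Proof.
move=> homX /hpoint_coordP [pj pi].
have p0 : chart j p = 0.
  by apply/rowP => k; rewrite chartE mxE pi ?mul0r // eq_sym neq_lift.
split=> [[i [pi0]]|iso].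
  have -> : i = j by apply/eqP; apply: contraNT pi0 => /pi ->.
  by rewrite chart_image // p0.
by exists j; split => //; rewrite chart_image // p0.
Qed.

Lemma co_unchart n j (w : 'rV[K]_n.+1) k : (j < n.+2)%N -> (k < n.+2)%N ->
  co (unchart (inord j) w) k = if k == j then 1 else co w (unbump j k).
Proof.
move=> hj hk; rewrite mxE; case: unliftP => [i E|E].
  have {E} := congr1 val E; rewrite /= !inordK // => ->.
  by rewrite eq_sym (negPf (neq_bump _ _)) bumpK inord_val.
by have := congr1 val E; rewrite /= !inordK // => ->; rewrite eqxx.
Qed.

Lemma co_chart n j (z : 'rV[K]_n.+2) k : (j < n.+2)%N -> (k < n.+1)%N ->
  co (chart (inord j) z) k = co z (bump j k) / co z j.
Proof.
move=> hj hk; rewrite chartE; congr (z 0 _ / _); apply: val_inj.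
have hb : (bump j k < n.+2)%N.
  by rewrite /bump; lia.
by rewrite /= !inordK.
Qed.

End Charts.

(** * The surface T: charts, smooth points and singular points *)

Section ScrollQuadric.
Variables (K : numClosedFieldType) (n : nat) (G : {poly K}).

(* T for G = prod_i (x - lambda_i); the coordinate z_k of the paper is co z k.-1. *)
Definition scroll_quadric : set 'rV[K]_n.+2 :=
  [set z : 'rV[K]_n.+2 | [/\ z != 0, rnc_cone (\row_(k < n) co z k) &
     co z n * co z n.+1 = co z 1 * \sum_(k < n) G`_k * co z k]].

(** This is T in both charts at points of [l_infty]: once one of the last two coordinates is 1, the
    quadric solves for the other. *)
Definition cone_graph : set 'rV[K]_n.+1 :=
  [set w | rnc_cone (\row_(k < n) co w k) /\
     co w n = co w 1 * \sum_(k < n) G`_k * co w k].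

Hypothesis n3 : (2 < n)%N.

Let n1 : (1 < n)%N. Proof. exact: ltnW. Qed.

Lemma scroll_quadricP (z : 'rV[K]_n.+2) : scroll_quadric z <->
  [/\ z != 0, (exists c x, forall k, (k < n)%N -> co z k = c * x ^+ k) \/
              (forall k, (k < n.-1)%N -> co z k = 0) &
     co z n * co z n.+1 = co z 1 * \sum_(k < n) G`_k * co z k].
Proof. by split=> -[z0 Cz Ez]; split => //; apply/(rnc_coneP (fun k => co z k) n1).
Qed.

Lemma scroll_quadric_scale c z : c != 0 -> scroll_quadric z -> scroll_quadric (c *: z).
Proof.
move=> c0 /scroll_quadricP [z0 cone_z quad_z]; apply/scroll_quadricP; split.
- by rewrite scaler_eq0 negb_or c0.
- case: cone_z => [[a [x zk]]|zk].
    by left; exists (c * a), x => k kn; rewrite mxE zk // mulrA.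
  by right => k kn; rewrite mxE zk // mulr0.
- have -> : \sum_(k < n) G`_k * co (c *: z) k = c * \sum_(k < n) G`_k * co z k.
    by rewrite mulr_sumr; apply: eq_bigr => k _; rewrite mxE mulrCA.
  by rewrite !mxE mulrACA quad_z mulrACA.
Qed.

Lemma germ_iso_cone_graph : germ_iso cone_graph 0 (@rnc_cone K n) 0.
Proof.
rewrite /cone_graph; case: n n1 => // m m1.
pose f (w : 'rV[K]_m.+2) : 'rV[K]_m.+1 := \row_k co w k.
pose s (v : 'rV[K]_m.+1) k :=
  if (k < m.+1)%N then co v k else co v 1 * \sum_(j < m.+1) G`_j * co v j.
pose g (v : 'rV[K]_m.+1) : 'rV[K]_m.+2 := \row_k s v k.
have cof w k : (k < m.+1)%N -> co (f w) k = co w k.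
  exact: (co_row (fun k => co w k)).
have cog v k : (k < m.+2)%N -> co (g v) k = s v k by exact: co_row.
have cogk v k : (k < m.+1)%N -> co (g v) k = co v k.
  by move=> km; rewrite cog /s ?km // ltnW.
have fg v : f (g v) = v.
  by apply: row_coP => k km; rewrite cof // cogk.
have sumE (v : 'rV[K]_m.+1) (w : 'rV[K]_m.+2) :
    (forall k, (k < m.+1)%N -> co v k = co w k) ->
    co v 1 * (\sum_(j < m.+1) G`_j * co v j) = co w 1 * \sum_(j < m.+1) G`_j * co w j.
  by move=> vw; rewrite vw //; congr (_ * _); apply: eq_bigr => j _; rewrite vw.
apply: (@germ_iso_global _ _ _ _ _ _ _ f g).
- move=> w; apply: (@mkrow_differentiable _ _ _ (fun (w : 'rV[K]_m.+2) k => co w k)) => k _.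
  exact: co_differentiable.
- move=> v; apply: (@mkrow_differentiable _ _ _ s) => k _; rewrite /s.
  case: (k < m.+1)%N; first exact: co_differentiable.
  apply: differentiableM; first exact: co_differentiable.
  apply: fun_sum_differentiable => j; apply: differentiableM => //.
  exact: co_differentiable.
- split; last by rewrite !mxE mul0r.
  apply/(rnc_coneP (fun k => co (0 : 'rV[K]_m.+2) k)) => //.
  by right => k _; rewrite mxE.
- by apply/rowP => k; rewrite !mxE.
- move=> w [Cw Ew]; split => //; apply: row_coP => k.
  rewrite ltnS leq_eqVlt => /orP[/eqP ->|km]; last by rewrite cogk // cof.
  by rewrite cog // /s ltnn Ew; apply: sumE => k' k'm; rewrite cof.
- move=> v Cv; split; last exact: fg.
  split; first by rewrite -/(f (g v)) fg.
  by rewrite cog // /s ltnn; apply: sumE => k km; rewrite cogk.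
Qed.

Lemma chart_cone j : (j = n \/ j = n.+1) ->
  [set w | scroll_quadric (unchart (inord j) w)] = cone_graph.
Proof.
move=> hj; have nj : (n <= j)%N by case: hj => ->.
have jn : (j < n.+2)%N by case: hj => ->.
have cow (w : 'rV[K]_n.+1) k : (k < n)%N -> co (unchart (inord j) w) k = co w k.
  move=> kn; rewrite co_unchart //; last by lia.
  by rewrite ltn_eqF ?(leq_trans kn) // (_ : unbump j k = k) // /unbump; lia.
have sumE (w : 'rV[K]_n.+1) : co (unchart (inord j) w) 1 *
   (\sum_(k < n) G`_k * co (unchart (inord j) w) k) =
   co w 1 * \sum_(k < n) G`_k * co w k.
  by rewrite cow //; congr (_ * _); apply: eq_bigr => k _; rewrite cow.
have rowE' (w : 'rV[K]_n.+1) : \row_(k < n) co (unchart (inord j) w) k = \row_(k < n) co w k.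
  by apply/rowP => k; rewrite [LHS]mxE [RHS]mxE cow.
(* Whichever of the two coordinates is set to 1, the other one lands at index [n] of [w], which
   treats both charts at once. *)
have prodE (w : 'rV[K]_n.+1) :
    co (unchart (inord j) w) n * co (unchart (inord j) w) n.+1 = co w n.
  by case: hj => ->; rewrite !co_unchart // eqxx ?(ltn_eqF (ltnSn n)) ?(gtn_eqF (ltnSn n))
    ?mul1r ?mulr1; congr (w 0 (inord _)); rewrite /unbump; lia.
apply/seteqP; split=> w.
  by move=> [_ Cw Ew]; split; [rewrite -rowE'|rewrite -sumE -Ew prodE].
move=> [Cw Ew]; split; first last.
- by rewrite prodE sumE.
- by rewrite rowE'.
apply/eqP => /rowP /(_ (inord j)) /eqP; rewrite co_unchart // eqxx mxE.
by rewrite oner_eq0.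
Qed.

Lemma germ_iso_chart_cone j : (j = n \/ j = n.+1) ->
  germ_iso [set w | scroll_quadric (unchart (inord j) w)] 0 (@rnc_cone K n) 0.
Proof. by move=> hj; rewrite chart_cone //; exact: germ_iso_cone_graph. Qed.

Lemma scroll_quadric_coord j p : (n.-1 <= j)%N -> (j < n.+2)%N ->
  hpoint (delta_mx 0 (inord j)) p -> scroll_quadric p.
Proof.
move=> nj jn /hpoint_coordP [pj pi].
have pk k : (k < n.+2)%N -> k != j -> co p k = 0.
  move=> kn kj; apply: pi; apply: contra kj => /eqP /(congr1 val).
  by rewrite /= !inordK // => ->.
apply/scroll_quadricP; split.
- by apply: contraNneq pj => ->; rewrite mxE.
- by right => k kn; apply: pk; lia.
- rewrite (pk 1%N) ?mul0r //; last by lia.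
  have [jn'|jn'] := eqVneq j n; last by rewrite pk ?mul0r //; lia.
  by rewrite [X in _ * X]pk ?mulr0 //; lia.
Qed.

(** On this line the right side of the quadric vanishes, leaving the product of the last two
    coordinates equal to 0. *)
Lemma scroll_quadric_infty :
  [set z : 'rV[K]_n.+2 | z != 0 /\ forall k, (k < n)%N -> co z k = 0] `&` scroll_quadric =
  hpoint (delta_mx 0 (inord n)) `|` hpoint (delta_mx 0 (inord n.+1)).
Proof.
apply/seteqP; split=> z.
  move=> [[z0 zk] Tz]; have [_ _ Ez] := (scroll_quadricP z).1 Tz.
  have coordP j l : (n <= j)%N -> (j < n.+2)%N -> (n <= l)%N -> (l < n.+2)%N -> j != l ->
      co z l = 0 -> hpoint (delta_mx 0 (inord j)) z.
    move=> nj jn nl ln jl zl.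
    have zi (i : 'I_n.+2) : i != inord j -> z 0 i = 0.
      move=> ij; rewrite -(inord_val i); have [kn|nk] := ltnP i n; first exact: zk.
      have ij' : nat_of_ord i != j.
        by apply: contra ij => /eqP <-; rewrite inord_val.
      by have -> : nat_of_ord i = l by have := ltn_ord i; lia.
    apply/hpoint_coordP; split=> //.
    apply: contra z0 => /eqP pj; apply/eqP/rowP => i; rewrite mxE.
    by have [->|/zi] := eqVneq i (inord j).
  have : co z n * co z n.+1 = 0 by rewrite Ez zk ?mul0r.
  move/eqP; rewrite mulf_eq0 => /orP[/eqP zn|/eqP zn].
    by right; apply: (coordP _ n) => //; lia.
  by left; apply: (coordP _ n.+1) => //; lia.
have coord j : (j = n \/ j = n.+1) -> hpoint (delta_mx 0 (inord j)) z ->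
    ([set z : 'rV[K]_n.+2 | z != 0 /\ forall k, (k < n)%N -> co z k = 0] `&`
      scroll_quadric) z.
  move=> hj zj; have Tz : scroll_quadric z by apply: (scroll_quadric_coord _ _ zj); lia.
  split => //; split; first by have [] := (scroll_quadricP z).1 Tz.
  have [_ zi] := (hpoint_coordP _ _).1 zj.
  move=> k kn; apply: zi; apply/eqP => /(congr1 val).
  by rewrite /= !inordK; lia.
by case; apply: coord; [left|right].
Qed.

Hypothesis sizeG : size G = n.

(** With z_1 = 1 the scale c is 1 and the entry at index [k] of the chart is x^(k+1). The factor z_2
    contributes x and the sum becomes G(x). *)
Lemma chart_first :
  [set w | scroll_quadric (unchart (inord 0) w)] =
  hypersurface_over succn 0 ('X * G).
Proof.
have cow (w : 'rV[K]_n.+1) k : (k < n.+1)%N -> co (unchart (inord 0) w) k.+1 = co w k.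
  by move=> kn; rewrite co_unchart // /unbump subn1.
have co0 (w : 'rV[K]_n.+1) : co (unchart (inord 0) w) 0 = 1.
  by rewrite co_unchart.
have En : n = n.-1.+1 by rewrite prednK // ltnW.
have prodE (w : 'rV[K]_n.+1) : co (unchart (inord 0) w) n * co (unchart (inord 0) w) n.+1 =
    co w n.-1 * co w n.
  rewrite -cow //; last by rewrite ltnS leq_pred.
  by rewrite -cow // -En.
have n10 : (0 < n.-1)%N by rewrite ltn_predRL.
apply/seteqP; split=> w.
  (* The line over the point at infinity of the curve has z_1 = 0 and does not meet this chart. *)
  move=> /scroll_quadricP [_ [[c [x zk]]|zk]] Ew; last first.
    by have /eqP := zk 0%N n10; rewrite co0 oner_eq0.
  have c1 : c = 1 by rewrite -(co0 w) zk ?expr0 ?mulr1 // ltnW.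
  have wx : co w 0 = x by rewrite -cow // zk // c1 mul1r expr1.
  split.
    move=> k kn; rewrite wx -cow; last by rewrite (leq_trans kn) // (leq_trans (leq_pred n)).
    by rewrite zk ?c1 ?mul1r // -ltn_predRL.
  rewrite -prodE Ew hornerM hornerX cow // horner_coef sizeG; congr (_ * _).
  apply: eq_bigr => k _; rewrite wx; congr (_ * _); rewrite zk // c1 mul1r //.
move=> [wk Ew]; have zk k : (k < n)%N -> co (unchart (inord 0) w) k = co w 0 ^+ k.
  case: k => [|k] kn; first by rewrite co0 expr0.
  by rewrite cow; [apply: wk|]; lia.
apply/scroll_quadricP; split.
- apply/eqP => /rowP /(_ (inord 0)) /eqP; rewrite co0 mxE.
  by rewrite oner_eq0.
- by left; exists 1, (co w 0) => k kn; rewrite mul1r zk.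
- rewrite prodE Ew hornerM hornerX cow // horner_coef sizeG; congr (_ * _).
  by apply: eq_bigr => k _; rewrite zk.
Qed.

(** This is x^(n-1) G(1/x), that is prod_i (1 - lambda_i x) for G = prod_i (x - lambda_i). *)
Definition reverse_poly : {poly K} := \poly_(k < n) G`_(n.-1 - k).

(** The parameter is y = 1/x, found at index n-2. Since the entry at index k is y^(n-1-k), the
    factor z_2 gives y^(n-2), the source of the singularity at y = 0. *)
Lemma chart_last :
  [set w | scroll_quadric (unchart (inord n.-1) w)] =
  hypersurface_over (fun k => (n.-1 - k)%N) (n - 2) ('X^(n - 2) * reverse_poly).
Proof.
have n12 : (n - 2 = n.-1.-1)%N by rewrite -subn2.
have n10 : (0 < n.-1)%N by rewrite ltn_predRL.
have En : n = n.-1.+1 by rewrite prednK // ltnW.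
have n1n : (n.-1 < n.+2)%N by rewrite ltnS (leq_trans (leq_pred n)).
have cow (w : 'rV[K]_n.+1) k : (k < n.-1)%N -> co (unchart (inord n.-1) w) k = co w k.
  move=> kn; rewrite co_unchart //; last by rewrite (ltn_trans kn).
  by rewrite ltn_eqF // /unbump ltnNge (ltnW kn) subn0.
have co1 (w : 'rV[K]_n.+1) : co (unchart (inord n.-1) w) n.-1 = 1.
  by rewrite co_unchart // eqxx.
have prodE (w : 'rV[K]_n.+1) :
    co (unchart (inord n.-1) w) n * co (unchart (inord n.-1) w) n.+1 =
    co w n.-1 * co w n.
  rewrite !co_unchart // !gtn_eqF ?ltnS ?leq_pred //; last by rewrite [X in (_ < X)%N]En.
  rewrite /unbump ltnS leq_pred [X in (_ < X)%N]En ltnSn !subn1 //.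
have hornerE' (x : K) : reverse_poly.[x] = \sum_(k < n) G`_k * x ^+ (n.-1 - k).
  rewrite horner_poly (reindex_inj rev_ord_inj) /=; apply: eq_bigr => k _.
  have kn : (k <= n.-1)%N by rewrite -ltnS -En.
  have -> : (n - k.+1 = n.-1 - k)%N by lia.
  by congr (G`_ _ * _); lia.
have i0n : (n - 2 < n.-1)%N by rewrite n12 ltn_predL.
have exp1 : (n.-1 - (n - 2) = 1)%N by lia.
suff H w : scroll_quadric (unchart (inord n.-1) w) <->
    exists2 y : K, (forall k, (k < n.-1)%N -> co w k = y ^+ (n.-1 - k)) &
      co w n.-1 * co w n = y ^+ (n - 2) * reverse_poly.[y].
  apply/seteqP; split=> w.
    move=> /H [y wk Ew]; have wy : co w (n - 2) = y by rewrite wk // exp1.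
    by split; rewrite wy // Ew hornerM hornerXn.
  by move=> [wk Ew]; apply/H; exists (co w (n - 2)) => //; rewrite Ew hornerM hornerXn.
have quadE y : (forall k, (k < n)%N -> co (unchart (inord n.-1) w) k = y ^+ (n.-1 - k)) ->
    co (unchart (inord n.-1) w) 1 * (\sum_(k < n) G`_k * co (unchart (inord n.-1) w) k) =
    y ^+ (n - 2) * reverse_poly.[y].
  move=> zk; rewrite zk // hornerE' n12 subn1; congr (_ * _).
  by apply: eq_bigr => k _; rewrite zk.
split.
  move=> /scroll_quadricP [_ Cz Ew].
  have [y zk] : exists y, forall k, (k < n)%N ->
      co (unchart (inord n.-1) w) k = y ^+ (n.-1 - k).
    (* The line over the point at infinity is y = 0, where the entry at index n-1 is [0 ^+ 0], that
       is 1. *)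
    case: Cz => [[c [x zk]]|zk]; last first.
      exists 0 => k; rewrite [X in (_ < X)%N]En ltnS leq_eqVlt => /orP[/eqP->|kn].
        by rewrite co1 subnn expr0.
      by rewrite zk // expr0n subn_eq0 leqNgt kn.
    have cx : c * x ^+ n.-1 = 1 by rewrite -zk ?co1 // [X in (_ < X)%N]En.
    have x0 : x != 0.
      by apply/eqP => x0; move/eqP: cx; rewrite x0 expr0n gtn_eqF // mulr0 eq_sym oner_eq0.
    exists x^-1 => k kn; rewrite zk //.
    have kn' : (k <= n.-1)%N by rewrite -ltnS -En.
    apply: (mulIf (expf_neq0 (n.-1 - k) x0)).
    by rewrite -mulrA -exprD subnKC // cx exprVn mulVf // expf_neq0.
  exists y; last by rewrite -(quadE y) // -Ew prodE.
  by move=> k kn; rewrite -cow // zk // (leq_trans kn) // leq_pred.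
move=> [y wk Ew].
have zk k : (k < n)%N -> co (unchart (inord n.-1) w) k = y ^+ (n.-1 - k).
  rewrite [X in (_ < X)%N]En ltnS leq_eqVlt => /orP[/eqP->|kn].
    by rewrite co1 subnn expr0.
  by rewrite cow // wk.
apply/scroll_quadricP; split.
- apply/eqP => /rowP /(_ (inord n.-1)) /eqP; rewrite co1 mxE.
  by rewrite oner_eq0.
- have [y0|y0] := eqVneq y 0; [right => k kn|left].
    by rewrite zk ?(leq_trans kn) ?leq_pred // y0 expr0n subn_eq0 leqNgt kn.
  exists (y ^+ n.-1), y^-1 => k kn; rewrite zk //.
  have kn' : (k <= n.-1)%N by rewrite -ltnS -En.
  by rewrite -[in RHS](subnK kn') exprD exprVn mulfK // expf_neq0.
- by rewrite prodE Ew (quadE y).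
Qed.

Lemma scroll_quadric_smooth_first p : (forall x, ('X * G).[x] = 0 -> ('X * G)^`().[x] != 0) ->
  scroll_quadric p -> co p 0 != 0 -> smooth_point scroll_quadric p.
Proof.
move=> sepG Tp p0; exists 2, (inord 0); split => //.
have : (chart (inord 0) @` (scroll_quadric `&` [set z | co z 0 != 0])) (chart (inord 0) p).
  by exists p.
rewrite (chart_image _ scroll_quadric_scale) chart_first.
set w := chart _ _ => Hw; have := Hw => -[_ Fw].
have n10 : (0 < n.-1)%N by rewrite ltn_predRL.
apply: (germ_iso_hypersurface_smooth (germ_iso_hypersurface_over n10 _ Hw)) => //.
rewrite !co_seqrow //=.
have [w1|//] := eqVneq (co w n.-1) 0; have [w2|//] := eqVneq (co w n) 0.
by apply: sepG; rewrite -Fw w1 mul0r.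
Qed.

Lemma scroll_quadric_smooth_last p : scroll_quadric p -> co p n.-1 != 0 ->
  (co p n != 0) || (co p n.+1 != 0) -> smooth_point scroll_quadric p.
Proof.
move=> Tp p1 pn; exists 2, (inord n.-1); split => //.
have : (chart (inord n.-1) @` (scroll_quadric `&` [set z | co z n.-1 != 0]))
    (chart (inord n.-1) p) by exists p.
rewrite (chart_image _ scroll_quadric_scale) chart_last.
set w := chart _ _ => Hw.
have n20 : (n - 2 < n.-1)%N by lia.
have e1 : (n.-1 - (n - 2) = 1)%N by lia.
apply: (germ_iso_hypersurface_smooth (germ_iso_hypersurface_over n20 _ Hw)) => //.
rewrite !co_seqrow //= /w !co_chart //; try lia.
rewrite (_ : bump _ _ = n); last by rewrite /bump; lia.
rewrite (_ : bump _ _ = n.+1); last by rewrite /bump; lia.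
by rewrite !mulf_eq0 invr_eq0 (negPf p1) !orbF orbA pn.
Qed.

(** If z_1 = 0, all cone coordinates except z_n vanish. Then either z_n <> 0, and the point is
    smooth unless the last two coordinates are 0, or the point lies on [l_infty], where the quadric
    leaves only two coordinate points. *)
Lemma scroll_quadric_smooth p :
  (forall x, ('X * G).[x] = 0 -> ('X * G)^`().[x] != 0) -> scroll_quadric p ->
  ~ hpoint (delta_mx 0 (inord n)) p -> ~ hpoint (delta_mx 0 (inord n.+1)) p ->
  ~ hpoint (delta_mx 0 (inord n.-1)) p -> smooth_point scroll_quadric p.
Proof.
move=> sepG Tp na1 na2 nb.
have [p0|] := eqVneq (co p 0) 0; last exact: scroll_quadric_smooth_first.
have [pn0 Cp Ep] := (scroll_quadricP p).1 Tp.
have pk k : (k < n.-1)%N -> co p k = 0.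
  case: Cp => [[c [x zk]]|]; last exact.
  have c0 : c = 0 by rewrite -p0 zk ?expr0 ?mulr1 // ltnW.
  by move=> kn; rewrite zk ?c0 ?mul0r //; lia.
have coordP j : (n.-1 <= j)%N -> (j < n.+2)%N ->
    (forall k, (n.-1 <= k)%N -> (k < n.+2)%N -> k != j -> co p k = 0) ->
    hpoint (delta_mx 0 (inord j)) p.
  move=> nj jn pkj.
  have pi (i : 'I_n.+2) : i != inord j -> p 0 i = 0.
    move=> ij; rewrite -(inord_val i); have [kn|nk] := ltnP i n.-1; first exact: pk.
    by apply: pkj => //; apply: contra ij => /eqP <-; rewrite inord_val.
  apply/hpoint_coordP; split=> //.
  apply: contra pn0 => /eqP pj; apply/eqP/rowP => i; rewrite mxE.
  by have [->|/pi] := eqVneq i (inord j).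
have [p1|p1] := eqVneq (co p n.-1) 0; last first.
  have [pn|pn] := eqVneq (co p n) 0; last by apply: scroll_quadric_smooth_last; rewrite ?pn.
  have [pn1|pn1] := eqVneq (co p n.+1) 0; last by apply: scroll_quadric_smooth_last; rewrite ?pn1 ?orbT.
  case: nb; apply: coordP; [by []|by lia|] => k nk kn kj.
  have : (k == n) || (k == n.+1) by lia.
  by case/orP => /eqP ->.
have : co p n * co p n.+1 = 0 by rewrite Ep pk ?mul0r //; lia.
move/eqP; rewrite mulf_eq0 => /orP[/eqP pn|/eqP pn].
  case: na2; apply: coordP; [by lia|by []|] => k nk kn kj.
  have : (k == n.-1) || (k == n) by lia.
  by case/orP => /eqP ->.
case: na1; apply: coordP; [by lia|by lia|] => k nk kn kj.
have : (k == n.-1) || (k == n.+1) by lia.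
by case/orP => /eqP ->.
Qed.

(** The constant term is the leading coefficient of [G]. *)
Lemma reverse_poly_at0 : reverse_poly.[0] != 0.
Proof.
rewrite horner_coef0 coef_poly (ltn_trans _ n1) // subn0 -sizeG.
by rewrite -/(lead_coef G) lead_coef_eq0 -size_poly_gt0 sizeG ltnW // ltnW.
Qed.

Lemma germ_iso_chart_last :
  germ_iso [set w | scroll_quadric (unchart (inord n.-1) w)] 0
    (hypersurface ('X^(n - 2) : {poly K})) 0.
Proof.
have H0 : hypersurface_over (fun k => (n.-1 - k)%N) (n - 2)
    ('X^(n - 2) * reverse_poly) (0 : 'rV[K]_n.+1).
  split; last by rewrite !mxE mul0r hornerM hornerXn expr0n subn_eq0 leqNgt n3 mul0r.
  by move=> k kn; rewrite !mxE expr0n subn_eq0 leqNgt kn.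
have n20 : (n - 2 < n.-1)%N by lia.
have e1 : (n.-1 - (n - 2) = 1)%N by lia.
rewrite chart_last; apply: (germ_iso_trans (germ_iso_hypersurface_over n20 e1 H0)).
rewrite (_ : \row_i _ = 0).
  apply: germ_iso_hypersurface_unit; first exact: reverse_poly_at0.
  by rewrite hornerXn expr0n subn_eq0 leqNgt n3.
by apply: row_coP; case=> [|[|[|]]] // _; rewrite co_seqrow //= !mxE.
Qed.

Lemma scroll_quadric_singular_locus : (3 < n)%N ->
  (forall x, ('X * G).[x] = 0 -> ('X * G)^`().[x] != 0) ->
  singular_locus scroll_quadric =
  hpoint (delta_mx 0 (inord n)) `|` hpoint (delta_mx 0 (inord n.+1)) `|`
  hpoint (delta_mx 0 (inord n.-1)).
Proof.
move=> n4 sepG; apply/seteqP; split=> p.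
  move=> [Tp nsm].
  have [//|nb] := pselect (hpoint (delta_mx 0 (inord n.-1)) p); first by right.
  have [//|na1] := pselect (hpoint (delta_mx 0 (inord n)) p); first by left; left.
  have [//|na2] := pselect (hpoint (delta_mx 0 (inord n.+1)) p); first by left; right.
  by case: nsm; exact: scroll_quadric_smooth.
have cone_case j : (j = n \/ j = n.+1) -> hpoint (delta_mx 0 (inord j)) p ->
    singular_locus scroll_quadric p.
  move=> hj pj; split; first by apply: (scroll_quadric_coord _ _ pj); lia.
  move=> [d /(proj_germ_iso_coord _ _ scroll_quadric_scale pj) iso].
  apply: (rnc_cone_nonsmooth n3).
  exact: (germ_iso_trans (germ_iso_sym (germ_iso_chart_cone hj)) iso).
case=> [[|]|pj]; [by apply: cone_case; left|by apply: cone_case; right|].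
split; first by apply: (scroll_quadric_coord _ _ pj); lia.
move=> [d /(proj_germ_iso_coord _ _ scroll_quadric_scale pj) iso].
(* For n = 3 the exponent would be 1, and u w = x is smooth. *)
have n21 : (1 < n - 2)%N by lia.
apply: (hypersurface_nonsmooth n21).
exact: (germ_iso_trans (germ_iso_sym germ_iso_chart_last) iso).
Qed.

Lemma scroll_quadric_A_singularity : (3 < n)%N ->
  A_singularity (n - 3) scroll_quadric (delta_mx 0 (inord n.-1)).
Proof.
move=> n4; apply/(proj_germ_iso_coord _ _ scroll_quadric_scale (hpoint_coord_refl _ _)).
apply: (germ_iso_trans germ_iso_chart_last).
rewrite (_ : (n - 2 = (n - 3).+1)%N); last by lia.
exact: germ_iso_hypersurface_du_val.
Qed.

End ScrollQuadric.

(** * Invariants of the cyclic group *)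

Section Invariants.
Variable K : numClosedFieldType.

Let X0 : mpoly.mpoly 2 K := mpoly.mpolyX K (mpoly.mnm1 ord0).
Let X1 : mpoly.mpoly 2 K := mpoly.mpolyX K (mpoly.mnm1 ord_max).

Lemma mdeg2 (a : mpoly.multinom 2) : mpoly.mdeg a = (a ord0 + a ord_max)%N.
Proof.
rewrite mpoly.mdegE big_ord_recl big_ord1; congr (_ + a _)%N; exact: val_inj.
Qed.

(* The substitution (s, s^N) with N larger than the degree separates the monomials. *)
Lemma scaling_invariant_mdeg (P : mpoly.mpoly 2 K) (z : K) a :
  (forall v, mpoly.meval (fun i => z * v i) P = mpoly.meval v P) ->
  a \in mpoly.msupp P -> z ^+ mpoly.mdeg a = 1.
Proof.
move=> invP aP; pose N := mpoly.msize P.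
pose kap (b : mpoly.multinom 2) := (b ord0 + N * b ord_max)%N.
have degN b : b \in mpoly.msupp P -> (b ord0 < N)%N.
  by move=> /mpoly.msize_mdeg_lt; apply: leq_ltn_trans; rewrite mdeg2 leq_addr.
have kap_inj b : b \in mpoly.msupp P -> (kap b == kap a) = (b == a).
  move=> bP; apply/eqP/eqP => [E|-> //]; have [bN aN] := (degN _ bP, degN _ aP).
  have N0 : (0 < N)%N by exact: leq_ltn_trans aN.
  have E1 : b ord_max = a ord_max.
    have kap_div (c : mpoly.multinom 2) : (c ord0 < N)%N -> (kap c %/ N)%N = c ord_max.
      by move=> cN; rewrite /kap addnC mulnC divnMDl // divn_small // addn0.
    by rewrite -!kap_div // E.
  have E0 : b ord0 = a ord0 by move: E; rewrite /kap E1 => /addIn.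
  apply/mpoly.mnmP => i; case: (unliftP ord0 i) => [j|] ->; last exact: E0.
  by rewrite (_ : lift ord0 j = ord_max) //; apply: val_inj; rewrite /= ord1.
(* This is P(z v) - P(v) at v = (s, s^N), as a polynomial in s; invariance makes it vanish
   identically. *)
pose p : {poly K} := \sum_(b <- mpoly.msupp P)
  (mpoly.mcoeff b P * (z ^+ mpoly.mdeg b - 1)) *: 'X^(kap b).
have p0 : p = 0.
  apply: poly_eq0_horner => s.
  pose v (i : 'I_2) : K := if i == ord0 then s else s ^+ N.
  have vE (b : mpoly.multinom 2) : \prod_i v i ^+ b i = s ^+ kap b.
    rewrite big_ord_recl big_ord1 /v /= -exprM -exprD /kap.
    by congr (s ^+ (_ + N * b _)); apply: val_inj.
  have /eqP := invP v; rewrite !mpoly.mevalE -subr_eq0 -sumrB => /eqP.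
  rewrite /p horner_sum => Esum; rewrite -[RHS]Esum; apply: eq_bigr => b _.
  rewrite hornerZ hornerXn -vE -mulrA -mulrBr; congr (_ * _).
  have -> : \prod_i (z * v i) ^+ b i = z ^+ mpoly.mdeg b * \prod_i v i ^+ b i.
    by under eq_bigr do rewrite exprMn; rewrite big_split /= mpoly.mdegE -expr_sum.
  by rewrite mulrBl mul1r.
have : p`_(kap a) = 0 by rewrite p0 coef0.
rewrite coef_sum (bigD1_seq a) ?mpoly.msupp_uniq //= big_seq_cond big1 ?addr0.
  rewrite coefZ coefXn eqxx mulr1 => /eqP; rewrite mulf_eq0 subr_eq0.
  by rewrite (mpoly.mcoeff_eq0 P a) aP => /eqP.
move=> b /andP[bP ba]; rewrite coefZ coefXn eq_sym kap_inj // (negPf ba) mulr0 //.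
Qed.

(** The order matches the cone: where [X0] is nonzero, the monomials are c x^i with c = X0^(n-1) and
    x = X1/X0. *)
Definition monomials n : n.-tuple (mpoly.mpoly 2 K) :=
  [tuple X0 ^+ (n.-1 - i) * X1 ^+ i | i < n].

Lemma monomial_comp n q a b : (1 < n)%N -> (a + b = n.-1 * q)%N ->
  exists Q : mpoly.mpoly n K, X0 ^+ a * X1 ^+ b = mpoly.comp_mpoly (monomials n) Q.
Proof.
move=> n1; elim: q a b => [|q ih] a b.
  rewrite muln0 => /eqP; rewrite addn_eq0 => /andP[/eqP-> /eqP->].
  by exists 1; rewrite rmorph1 !expr0 mulr1.
(* One generator is split off, taking as many factors [X1] as possible; the remaining exponents
   again have sum a multiple of n-1. *)
move=> ab; pose j := minn b n.-1.
have jn : (j < n)%N by rewrite /j; lia.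
have ja : (n.-1 - j <= a)%N by rewrite /j; nia.
have jb : (j <= b)%N by rewrite geq_minl.
have [Q EQ] := ih (a - (n.-1 - j))%N (b - j)%N ltac:(by nia).
exists (mpoly.mpolyX K (mpoly.mnm1 (Ordinal jn)) * Q).
rewrite rmorphM /= mpoly.comp_mpolyXU -tnth_nth tnth_mktuple -EQ /=.
by rewrite mulrACA -!exprD !subnKC.
Qed.

(** Invariance under a primitive root forces n-1 to divide the degree of each monomial of [P], so
    each is a product of generators. *)
Lemma invariant_comp n (z : K) (P : mpoly.mpoly 2 K) : (1 < n)%N ->
  n.-1.-primitive_root z ->
  (forall v, mpoly.meval (fun i => z * v i) P = mpoly.meval v P) ->
  exists Q : mpoly.mpoly n K, P = mpoly.comp_mpoly (monomials n) Q.
Proof.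
move=> n1 prim_z invP; rewrite [P]mpoly.mpolyE big_seq.
apply: (big_ind (fun P => exists Q : mpoly.mpoly n K, P = mpoly.comp_mpoly (monomials n) Q)).
- by exists 0; rewrite raddf0.
- by move=> _ _ [Q1 ->] [Q2 ->]; exists (Q1 + Q2); rewrite raddfD.
move=> a aP; have := scaling_invariant_mdeg invP aP.
move/eqP; rewrite -(prim_order_dvd prim_z) mdeg2 => /dvdnP[q]; rewrite mulnC => Eq.
have [Q EQ] := monomial_comp n1 Eq.
exists (mpoly.mcoeff a P *: Q); rewrite mpoly.comp_mpolyZ -EQ; congr (_ *: _).
rewrite mpoly.mpolyXE_id big_ord_recl big_ord1.
by congr (_ * mpoly.mpolyX K (mpoly.mnm1 _) ^+ a _); exact: val_inj.
Qed.

Lemma meval_monomials n (i : 'I_n) v :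
  mpoly.meval v (tnth (monomials n) i) = v ord0 ^+ (n.-1 - i) * v ord_max ^+ i.
Proof.
by rewrite tnth_mktuple mpoly.mevalM !rmorphXn /= !mpoly.mevalXU.
Qed.

(** Surjectivity uses (n-1)-th roots: c (1, x, ...) is the image of (s, s x) with s^(n-1) = c. The
    line over the point at infinity is the image of s = 0. *)
Lemma rnc_cone_range n : (1 < n)%N ->
  @rnc_cone K n =
  range (fun v : 'rV[K]_2 => \row_i mpoly.meval (v 0) (tnth (monomials n) i)).
Proof.
move=> n1; have n0 : (0 < n.-1)%N by lia.
apply/seteqP; split=> v.
  have -> : v = \row_(k < n) (if insub (val k) is Some i then v 0 i else 0).
    by apply/rowP => k; rewrite mxE valK.
  move=> /(rnc_coneP (fun k => if insub k is Some i then v 0 i else 0) n1) Cv.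
  have [s [t vk]] : exists s t : K, forall k, (k < n)%N ->
      (if insub k is Some i then v 0 (i : 'I_n) else 0) = s ^+ (n.-1 - k) * t ^+ k.
    case: Cv => [[c [x vk]]|vk].
      exists (n.-1.-root c), (n.-1.-root c * x) => k kn.
      by rewrite vk // exprMn mulrA -exprD subnK ?rootCK //; lia.
    exists 0, (n.-1.-root (if insub n.-1 is Some i then v 0 (i : 'I_n) else 0)) => k kn.
    have [kn1|nk] := ltnP k n.-1.
      by rewrite (vk k) // expr0n subn_eq0 leqNgt kn1 mul0r.
    have -> : k = n.-1 by lia.
    by rewrite subnn expr0 mul1r rootCK.
  exists (\row_i [:: s; t]`_i) => //; apply/rowP => k.
  by rewrite !mxE meval_monomials !mxE /= vk.
move=> [w _ <-].
rewrite (_ : \row_i _ = \row_(k < n) (w 0 ord0 ^+ (n.-1 - k) * w 0 ord_max ^+ k)).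
  apply/(rnc_coneP (fun k => w 0 ord0 ^+ (n.-1 - k) * w 0 ord_max ^+ k) n1).
  have [w0|w0] := eqVneq (w 0 ord0) 0.
    by right => k kn; rewrite w0 expr0n subn_eq0 leqNgt kn mul0r.
  left; exists (w 0 ord0 ^+ n.-1), (w 0 ord_max / w 0 ord0) => k kn.
  rewrite expr_div_n mulrA mulrAC; congr (_ * _).
  by rewrite expfB_cond // (negPf w0) add0n; lia.
by apply/rowP => k; rewrite !mxE meval_monomials.
Qed.

End Invariants.

(** * The primitive root of unity, and the quadric in terms of the lambda_i *)

Section Complex.
Variable R : realType.

Lemma cos_sin_exp (t : R) d :
  ((cos t +i* sin t) ^+ d = cos (t *+ d) +i* sin (t *+ d))%C.
Proof.
elim: d => [|d ih]; first by rewrite expr0 mulr0n cos0 sin0.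
rewrite exprS ih mulrS cosD sinD; apply/eqP.
by rewrite eq_complex /= addrC eqxx /= [X in X == _]addrC eqxx.
Qed.

(** Writing the angle of a power as 2x with 0 < x < pi, the real part 1 - 2 sin(x)^2 is less than
    1. *)
Lemma zeta_primitive m : (0 < m)%N -> m.-primitive_root (zeta R m).
Proof.
move=> m0; apply/andP; split => //; apply/forallP => -[i im] /=.
have mR : 0 < m%:R :> R by rewrite ltr0n.
have angle : (2 * pi / m%:R) *+ i.+1 = (pi * i.+1%:R / m%:R) *+ 2 :> R.
  by rewrite -(mulr_natr _ i.+1) -(mulr_natr _ 2); ring.
rewrite unity_rootE /zeta cos_sin_exp angle.
have [->|ni] := eqVneq i.+1 m.
  by rewrite mulfK ?lt0r_neq0 // cos2pi sin2pi eqxx.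
apply/eqP/negbTE/eqP => /(congr1 (@complex.Re R)) /=.
set x := pi * _ / _.
have xpi : 0 < x < pi.
  rewrite divr_gt0 ?mulr_gt0 ?pi_gt0 ?ltr0n //= ltr_pdivrMr // ltr_pM2l ?pi_gt0 //.
  by rewrite ltr_nat ltn_neqAle ni.
have sx : 0 < sin x by exact: sin_gt0_pi.
rewrite mulr2n cosD -!expr2 cos2sin2 => E.
have := exprn_gt0 2 sx; rewrite lt0r => /andP[/eqP[]].
by lra.
Qed.

(** Vieta's formula over the reals, transported to the complex numbers. *)
Lemma sigma_coef n (lam : 'I_n.-1 -> R) k : (0 < n)%N -> (k < n)%N ->
  (\prod_(i < n.-1) ('X - (lam i)%:C%C%:P))`_(n.-1 - k) =
  (-1) ^+ k * (sigma lam k)%:C%C.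
Proof.
move=> n0 kn; have kn1 : (k < n.-1.+1)%N by rewrite prednK.
have := mpoly.mroots_coeff [tuple lam i | i < n.-1] (Ordinal kn1).
rewrite big_tuple /= => /(congr1 (real_complex R)).
rewrite rmorphM rmorphXn rmorphN1 -coef_map /= rmorph_prod.
under eq_bigr do rewrite /= map_polyXsubC tnth_mktuple.
move=> ->; congr (_ * _%:C%C); apply: mpoly.meval_eq => i.
by rewrite tnth_mktuple.
Qed.

(** The quadric lists its terms from z_n downwards and counts coordinates from 1, so the sum is
    reversed and shifted to match the coefficients of [G]. *)
Lemma surfaceTE n (lam : 'I_n.-1 -> R) : (0 < n)%N ->
  surfaceT lam =
  @scroll_quadric R[i] n (\prod_(i < n.-1) ('X - (lam i)%:C%C%:P)).
Proof.
move=> n0; set G := \prod_(i < _) _; apply/funext => z; apply/propext.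
suff E : \sum_(k < n) (-1) ^+ k * (sigma lam k)%:C%C * hcoord z (n - k) =
    \sum_(k < n) G`_k * z 0 (inord k).
  by rewrite /surfaceT /scroll_quadric /= E.
rewrite [RHS](reindex_inj rev_ord_inj) /=; apply: eq_bigr => k _.
rewrite -sigma_coef // /hcoord -/G (_ : (n - k).-1 = n - k.+1)%N; last by lia.
by congr (G`_ _ * _); lia.
Qed.

End Complex.

Lemma separable_prod_root (K : numFieldType) n (lam : 'I_n -> K) :
  injective lam -> (forall i, lam i != 0) ->
  let F := 'X * \prod_(i < n) ('X - (lam i)%:P) in
  forall x, F.[x] = 0 -> F^`().[x] != 0.
Proof.
move=> lam_inj lam0 F x Fx.
have FE : F = \prod_(r <- 0 :: [seq lam i | i <- enum 'I_n]) ('X - r%:P).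
  by rewrite big_cons subr0 big_map big_enum.
have : separable_poly F.
  rewrite FE separable_prod_XsubC /= map_inj_uniq // enum_uniq andbT.
  by apply/mapP => -[i _ /eqP]; rewrite eq_sym (negPf (lam0 i)).
by rewrite unlock => sepF; apply: (coprimep_root sepF); apply/eqP.
Qed.

Theorem proposition2p13 (R : realType) (n : nat) (hn : (4 <= n)%N)
    (lam : 'I_n.-1 -> R) (lam_inj : injective lam)
    (lam_neq0 : forall i, lam i != 0) :
  let T := surfaceT lam in
  let a1 := coord_point R[i] n n.+1 in
  let a2 := coord_point R[i] n n.+2 in
  let b := coord_point R[i] n n in
  [/\ singular_locus T = hpoint a1 `|` hpoint a2 `|` hpoint b,
      l_infty R[i] n `&` T = hpoint a1 `|` hpoint a2,
      [/\ hpoint a1 <> hpoint a2, hpoint a1 <> hpoint b & hpoint a2 <> hpoint b],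
      cyclic_quotient_singularity n.-1 T a1 /\
      cyclic_quotient_singularity n.-1 T a2 &
      A_singularity (n - 3) T b].
Proof.
move=> T a1 a2 b.
have n2 : (2 < n)%N by lia. have n1 : (1 < n)%N by lia. have n0 : (0 < n)%N by lia.
have TE : T = _ := surfaceTE lam n0.
pose G : {poly R[i]} := \prod_(i < n.-1) ('X - (lam i)%:C%C%:P).
have sizeG : size G = n.
  rewrite /G -(big_enum _ _ predT) /= size_prod_XsubC size_enum_ord prednK //.
have sepG : forall x, ('X * G).[x] = 0 -> ('X * G)^`().[x] != 0.
  apply: separable_prod_root => [i j /complexI /lam_inj //|i].
  by rewrite (inj_eq (@complexI R) _ 0).
have cyclic j : (j = n \/ j = n.+1) ->
    cyclic_quotient_singularity n.-1 T (delta_mx 0 (inord j)).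
  move=> hj; have prim : n.-1.-primitive_root (zeta R n.-1).
    by apply: zeta_primitive; lia.
  exists n, (monomials R[i] n); split; first split.
  - move=> i k v; rewrite !meval_monomials !exprMn mulrACA -exprD subnK; last first.
      by have := ltn_ord i; lia.
    by rewrite exprAC (prim_expr_order prim) expr1n mul1r.
  (* The generator zeta of the group suffices, being primitive. *)
  - move=> P invP; apply: (invariant_comp n1 prim).
    by move=> v; have := invP 1%N v; rewrite expr1.
  - have range0 : poly_map (monomials R[i] n) 0 = 0.
      apply/rowP => i; rewrite !mxE meval_monomials !mxE.
      have [i0|i0] := eqVneq (i : nat) 0%N; last first.
        by rewrite [X in _ * X]expr0n (negPf i0) mulr0.
      by rewrite i0 subn0 expr0n gtn_eqF ?mul0r //; lia.
    rewrite range0 /poly_map -(rnc_cone_range _ n1) TE.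
    apply/(proj_germ_iso_coord _ _ (@scroll_quadric_scale _ _ _ n2)).
      exact: hpoint_coord_refl.
    exact: germ_iso_chart_cone.
split.
- rewrite TE; exact: (scroll_quadric_singular_locus n2 sizeG hn sepG).
- rewrite TE -(scroll_quadric_infty G n2); congr (_ `&` _).
  apply/funext => z; apply/propext; split=> -[z0 zk]; split => // k hk.
    exact: (zk k.+1).
  by case: k hk => // k hk; exact: zk.
- have neq i j : (i < n.+2)%N -> (j < n.+2)%N -> i != j ->
      hpoint (delta_mx 0 (inord i) : 'rV[R[i]]_n.+2) <> hpoint (delta_mx 0 (inord j)).
    by move=> hi hj ij; apply: hpoint_coord_neq; rewrite -val_eqE /= !inordK.
  by split; apply: neq; lia.
- by split; apply: cyclic; [left|right].
- rewrite TE; exact: scroll_quadric_A_singularity.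
Qed.
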